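(* Let $\mathcal{M}$ be an MDP with integer weights and designated absorbing state $\mathit{goal}$. If $\mathit{PE}^{\sup}_{s_{\mathit{init}}}$ is finite in $\mathcal{M}$, then there is a weight-based deterministic scheduler $\mathfrak{S}$ with $\mathit{PE}^{\sup}_{s_{\mathit{init}}}=\mathit{PE}^{\mathfrak{S}}_{s_{\mathit{init}}}$.
   Context: A Markov decision process (MDP) is a tuple $\mathcal{M}=(S,\mathit{Act},P,s_{\mathit{init}},\mathit{wgt})$ with finite state set $S$, finite action set $\mathit{Act}$, initial state $s_{\mathit{init}}$, $P:S\times\mathit{Act}\times S\to[0,1]\cap\mathbb{Q}$ with $\sum_{t}P(s,\alpha,t)\in\{0,1\}$, and $\mathit{wgt}:S\times\mathit{Act}\to\mathbb{Z}$. $\mathit{Act}(s)$ is the (nonempty) set of actions $\alpha$ enabled in $s$, i.e. with $\sum_tP(s,\alpha,t)=1$. All states are assumed reachable from $s_{\mathit{init}}$. A state is absorbing if its only enabled action leads back to it with probability $1$ and weight $0$. For a finite path $\pi$ (alternating sequence of states and actions with positive transition probabilities), $\mathit{wgt}(\pi)$ is the sum of the weights of its steps and $\mathit{last}(\pi)$ its last state. A scheduler assigns to every finite path $\pi$ a probability distribution on $\mathit{Act}(\mathit{last}(\pi))$; it is deterministic if all these distributions are Dirac, and weight-based if its choice after $\pi$ depends only on $(\mathit{last}(\pi),\mathit{wgt}(\pi))$. $\mathbb{E}^{\mathfrak{S}}_s$ denotes expectation with respect to the induced measure on infinite paths from $s$. Standing assumption: there is a designated absorbing state $\mathit{goal}$,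 and all states from which $\mathit{goal}$ is not reachable are collapsed to one absorbing state $\mathit{fail}$. The random variable $\oplus^0\mathit{goal}$ has as value the weight accumulated until $\mathit{goal}$ on infinite paths reaching $\mathit{goal}$ and $0$ on all other paths. The partial expectation of $\mathfrak{S}$ is $\mathit{PE}^{\mathfrak{S}}_{s}=\mathbb{E}^{\mathfrak{S}}_{s}(\oplus^0\mathit{goal})$, and $\mathit{PE}^{\sup}_{s}=\sup_{\mathfrak{S}}\mathit{PE}^{\mathfrak{S}}_{s}$ over all (history-dependent, randomized) schedulers. *)

(* Defs.v *)
From HB Require Import structures.
From mathcomp Require Import all_boot all_order all_algebra.
From mathcomp Require Import all_classical all_reals all_analysis.

Set Implicit Arguments.
Unset Strict Implicit.
Unset Printing Implicit Defensive.

Import Order.TTheory GRing.Theory Num.Theory.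
Local Open Scope classical_set_scope.
Local Open Scope ring_scope.

Record mdp := MDP {
  state : finType;
  act : finType;
  trans : state -> act -> state -> rat;
  init : state;
  wgt : state -> act -> int;
  trans_itv : forall s a t, 0 <= trans s a t <= 1;
  trans_sum : forall s a,
    \sum_t trans s a t = 0 \/ \sum_t trans s a t = 1;
  act_nonempty : forall s, exists a, \sum_t trans s a t == 1 }.

Definition enabled (M : mdp) (s : state M) (a : act M) : bool :=
  \sum_t trans s a t == 1.

(* The finite path s a1 s1 ... an sn is represented by its first state s and
   the sequence [:: (a1, s1); ...; (an, sn)] of its steps. *)
Definition step (M : mdp) : finType := (act M * state M)%type.

Section finite_paths.
Variable M : mdp.
Implicit Types (s : state M) (h : seq (step M)).

Fixpoint is_path s h : bool :=
  if h is (a, t) :: h' then (0 < trans s a t) && is_path t h' else true.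

Definition last_state s h : state M := last s (unzip2 h).

Fixpoint path_wgt s h : int :=
  if h is (a, t) :: h' then wgt s a + path_wgt t h' else 0.

Definition reachable s t : Prop :=
  exists h, is_path s h /\ last_state s h = t.

Definition absorbing s : Prop :=
  exists a, [/\ enabled s a, forall b, enabled s b -> b = a,
                trans s a s = 1 & wgt s a = 0].

(* The states that cannot reach goal are collapsed: there is at most one, fail,
   and it is absorbing. There is none if goal is reachable from everywhere. *)
Definition fail_collapsed (goal : state M) : Prop :=
  forall s, ~ reachable s goal ->
    absorbing s /\ forall t, ~ reachable t goal -> t = s.

End finite_paths.

(* Only the values of a scheduler on actual finite paths are meaningful. *)
Record scheduler (R : realType) (M : mdp) := Scheduler {
  choose_act :> state M -> seq (step M) -> act M -> R;
  choose_act_ge0 : forall s h a, is_path s h -> 0 <= choose_act s h a;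
  choose_act_sum : forall s h, is_path s h -> \sum_a choose_act s h a = 1;
  choose_act_enabled : forall s h a, is_path s h ->
    ~~ enabled (last_state s h) a -> choose_act s h a = 0 }.

Definition deterministic (R : realType) (M : mdp) (sch : scheduler R M) :=
  forall s h, is_path s h -> exists a, sch s h a = 1.

Definition weight_based (R : realType) (M : mdp) (sch : scheduler R M) :=
  forall s h s' h', is_path s h -> is_path s' h' ->
    last_state s h = last_state s' h' -> path_wgt s h = path_wgt s' h' ->
    sch s h =1 sch s' h'.

(* An infinite path from a given state is represented by the sequence of its
   steps. Sequences violating [is_path] are kept in the space; they form a
   null set for every path measure below. *)
Definition inf_path (M : mdp) := nat -> step M.

HB.instance Definition _ (M : mdp) := Choice.on (inf_path M).
HB.instance Definition _ (M : mdp) := isPointed.Build (inf_path M)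
  (fun=> (xchoose (act_nonempty (init M)), init M)).

Definition prefix_of (M : mdp) (w : inf_path M) (n : nat) : seq (step M) :=
  mkseq w n.

Definition cylinder (M : mdp) (h : seq (step M)) : set (inf_path M) :=
  [set w | prefix_of w (size h) = h].

Definition path_space (M : mdp) := g_sigma_algebraType (range (@cylinder M)).

Section prefix_probability.
Variables (R : realType) (M : mdp) (sch : scheduler R M).

(* Conditional probability of continuing with the steps h, given that the
   path started in s and has performed the steps pre. *)
Fixpoint prob_after (s : state M) (pre h : seq (step M)) : R :=
  if h is (a, t) :: h' then
    sch s pre a * ratr (trans (last_state s pre) a t)
      * prob_after s (rcons pre (a, t)) h'
  else 1.

Definition prefix_prob (s : state M) (h : seq (step M)) : R :=
  prob_after s [::] h.

Lemma prob_after_cat s pre h1 h2 : prob_after s pre (h1 ++ h2) =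
  prob_after s pre h1 * prob_after s (pre ++ h1) h2.
Proof.
elim: h1 pre => [|[a t] h1 IH] pre /=; first by rewrite cats0 mul1r.
by rewrite IH mulrA cat_rcons.
Qed.

Lemma prefix_prob_rcons s h a t : prefix_prob s (rcons h (a, t)) =
  prefix_prob s h * (sch s h a * ratr (trans (last_state s h) a t)).
Proof. by rewrite /prefix_prob -cats1 prob_after_cat /= mulr1. Qed.

Lemma last_state_rcons (s : state M) h a t :
  last_state s (rcons h (a, t)) = t.
Proof. by rewrite /last_state /unzip2 map_rcons last_rcons. Qed.

Lemma is_path_rcons (s : state M) h a t : is_path s (rcons h (a, t)) =
  is_path s h && (0 < trans (last_state s h) a t).
Proof.
elim: h s => [|[b u] h IH] s /=; first by rewrite andbT.
by rewrite IH andbA.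
Qed.

Lemma prefix_prob_notpath s h : ~~ is_path s h -> prefix_prob s h = 0.
Proof.
elim/last_ind: h => [//|h [a t] IH]; rewrite is_path_rcons prefix_prob_rcons.
rewrite negb_and => /orP[/IH ->|]; first by rewrite mul0r.
have /andP[+ _] := trans_itv (last_state s h) a t.
by rewrite le_eqVlt => /orP[/eqP<-|->//] _; rewrite rmorph0 !mulr0.
Qed.

Lemma prefix_prob_ge0 s h : 0 <= prefix_prob s h.
Proof.
elim/last_ind: h => [|h [a t] IH]; first exact: ler01.
rewrite prefix_prob_rcons; have [hp|hp] := boolP (is_path s h); last first.
  by rewrite prefix_prob_notpath// mul0r.
have /andP[t0 _] := trans_itv (last_state s h) a t.
by apply: mulr_ge0 => //; apply: mulr_ge0; rewrite ?ler0q// choose_act_ge0.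
Qed.

Lemma prefix_prob_sum s h :
  \sum_x prefix_prob s (rcons h x) = prefix_prob s h.
Proof.
have [hp|hp] := boolP (is_path s h); last first.
  rewrite prefix_prob_notpath// big1// => -[a t] _.
  by rewrite prefix_prob_rcons prefix_prob_notpath// mul0r.
transitivity (\sum_a \sum_t prefix_prob s (rcons h (a, t))).
  by rewrite pair_bigA; apply: eq_bigr => -[].
rewrite -[RHS]mulr1 -(choose_act_sum sch hp) mulr_sumr; apply: eq_bigr => a _.
under eq_bigr do rewrite prefix_prob_rcons.
rewrite -mulr_sumr -mulr_sumr -rmorph_sum /=; congr (_ * _).
have [e|ne] := boolP (enabled (last_state s h) a).
  by rewrite (eqP e) rmorph1 mulr1.
by rewrite choose_act_enabled// mul0r.
Qed.

End prefix_probability.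

Section uniform01.
Variable R : realType.
Let D : set (measurableTypeR R) := `[0, 1[%classic.
Let mD : measurable D. Proof. exact: measurable_itv. Qed.

Definition unif01 : set (measurableTypeR R) -> \bar R :=
  mrestr (@lebesgue_measure R) mD.

HB.instance Definition _ := Measure.on unif01.

Let unif01_setT : unif01 setT = 1%E.
Proof.
by rewrite /unif01 /mrestr setTI lebesgue_measure_itv/= lte_fin ltr01 oppr0 addr0.
Qed.

HB.instance Definition _ := Measure_isProbability.Build _ _ _ unif01 unif01_setT.

End uniform01.

(* Existence of a probability measure with prescribed cylinder probabilities p:
   the half-open intervals of length p h, nested as the prefixes h are, turn a
   uniform point of [0, 1[ into a random infinite path. *)
Section extension.
Variables (R : realType) (M : mdp) (p : seq (step M) -> R).
Hypothesis p_ge0 : forall h, 0 <= p h.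
Hypothesis p_nil : p [::] = 1.
Hypothesis p_sum : forall h, \sum_x p (rcons h x) = p h.

Let A : seq (step M) := index_enum (step M).
Let off h (x : step M) : R := \sum_(y <- take (index x A) A) p (rcons h y).

Let x0 : step M := (xchoose (act_nonempty (init M)), init M).

Let memA x : x \in A. Proof. exact: mem_index_enum. Qed.

Let offS h x : off h x + p (rcons h x) =
  \sum_(y <- take (index x A).+1 A) p (rcons h y).
Proof.
have ix : (index x A < size A)%N by rewrite index_mem.
by rewrite (take_nth x ix) nth_index// -[rcons (take _ _) _]cats1 big_cat/= big_seq1.
Qed.

Let take_le h (m n : nat) : (m <= n)%N ->
  \sum_(y <- take m A) p (rcons h y) <= \sum_(y <- take n A) p (rcons h y).
Proof.
move=> mn; rewrite -(subnKC mn) takeD big_cat/= lerDl.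
by apply: sumr_ge0 => *; exact: p_ge0.
Qed.

Let off_lt h x y : (index x A < index y A)%N -> off h x + p (rcons h x) <= off h y.
Proof. by move=> xy; rewrite offS; exact: take_le. Qed.

Let off_ge0 h x : 0 <= off h x.
Proof. by apply: sumr_ge0 => *; exact: p_ge0. Qed.

Let off_le h x : off h x + p (rcons h x) <= p h.
Proof.
rewrite offS -p_sum; have := @take_le h (index x A).+1 (size A).
by rewrite take_size index_mem memA; exact.
Qed.

Let off_ex h u : 0 <= u < p h -> exists x, off h x <= u < off h x + p (rcons h x).
Proof.
move=> /andP[u0 up].
have ex : exists n, u < \sum_(y <- take n A) p (rcons h y).
  by exists (size A); rewrite take_size p_sum.
case: (ex_minnP ex) => -[|n] un nmin.
  by move: un; rewrite take0 big_nil ltNge u0.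
have nA : (n < size A)%N.
  rewrite ltnNge; apply/negP => An.
  move: un; rewrite take_oversize ?(leq_trans An)// => un.
  by have := nmin n; rewrite take_oversize// un ltnn => /(_ isT).
exists (nth x0 A n).
rewrite offS /off index_uniq ?index_enum_uniq// un andbT leNgt.
by apply/negP => /nmin; rewrite ltnn.
Qed.

Fixpoint lower_after (pre h : seq (step M)) : R :=
  if h is x :: h' then off pre x + lower_after (rcons pre x) h' else 0.
Let lower h := lower_after [::] h.

Let lower_rcons h x : lower (rcons h x) = lower h + off h x.
Proof.
suff H pre : lower_after pre (rcons h x) = lower_after pre h + off (pre ++ h) x.
  exact: H.
elim: h pre => [|y h IH] pre /=; first by rewrite addr0 add0r cats0.
by rewrite IH addrA cat_rcons.
Qed.

Let I h (u : R) := lower h <= u < lower h + p h.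

Let I_nil u : I [::] u = (0 <= u < 1).
Proof. by rewrite /I /lower/= p_nil add0r. Qed.

Let I_sub h x u : I (rcons h x) u -> I h u.
Proof.
rewrite /I lower_rcons => /andP[l r]; apply/andP; split.
  by apply: le_trans l; rewrite lerDl.
by apply: lt_le_trans r _; rewrite -addrA lerD2l.
Qed.

Let I_ex h u : I h u -> exists x, I (rcons h x) u.
Proof.
move=> /andP[l r]; have [|x] := @off_ex h (u - lower h).
  by rewrite subr_ge0 l ltrBlDl.
rewrite lerBrDl ltrBlDl addrA => xP; exists x.
by rewrite /I lower_rcons.
Qed.

Let I_uniq h x y u : I (rcons h x) u -> I (rcons h y) u -> x = y.
Proof.
wlog xy : x y / (index x A <= index y A)%N.
  move=> H Hx Hy; case: (leqP (index x A) (index y A)) => c; first exact: H.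
  by apply/esym/H => //; exact: ltnW.
move: xy; rewrite leq_eqVlt => /orP[/eqP e _ _|xy].
  by rewrite -(nth_index x (memA x)) e nth_index.
rewrite /I !lower_rcons => /andP[_ +] /andP[+ _] => l1 l2.
have := lt_le_trans (le_lt_trans l2 l1) _.
move=> /(_ (lower h + off h y)); rewrite ltxx => F.
by exfalso; apply/notF/F; rewrite -addrA lerD2l off_lt.
Qed.

Let next u h : step M := odflt x0 [pick x | I (rcons h x) u].
Fixpoint hist u n := if n is m.+1 then rcons (hist u m) (next u (hist u m)) else [::].
Definition path_at (u : measurableTypeR R) : path_space M := fun n => next u (hist u n).

Let hist_prefix u n : prefix_of (path_at u) n = hist u n.
Proof. by elim: n => //= n IH; rewrite /prefix_of mkseqS -/(prefix_of _ _) IH. Qed.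

Let next_in h u : I h u -> I (rcons h (next u h)) u.
Proof.
move=> /I_ex[x xP]; rewrite /next; case: pickP => [//|/(_ x)].
by rewrite xP.
Qed.

Let hist_in u n : I [::] u -> I (hist u n) u.
Proof. by move=> u1; elim: n => //= n IH; exact: next_in. Qed.

Let histP u h : I [::] u -> hist u (size h) = h <-> I h u.
Proof.
move=> u1; split => [<-|]; first exact: hist_in.
elim/last_ind: h => [//|h x IH] hx.
rewrite size_rcons /= IH; last exact: I_sub hx.
by have hn := next_in (I_sub hx); congr rcons; exact: I_uniq hn hx.
Qed.

Let hist_out u n : ~~ I [::] u -> hist u n = nseq n x0.
Proof.
move=> u1; elim: n => // n IH.
rewrite -[LHS]/(rcons (hist u n) (next u (hist u n))) IH.
have outh h : ~~ I h u.
  elim/last_ind: h => // h x; apply: contra; exact: I_sub.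
rewrite /next; case: pickP => [x|_]; first by rewrite (negbTE (outh _)).
by rewrite /= -cats1 -[[:: x0]]/(nseq 1 x0) -nseqD addn1.
Qed.

Let path_at_cyl h : path_at @^-1` cylinder h `&` `[0, 1[%classic =
  `[lower h, lower h + p h[%classic.
Proof.
have sub u : I h u -> I [::] u.
  elim/last_ind: h => // h x IH hx; exact: IH (I_sub hx).
apply/seteqP; split => u /=.
  rewrite /cylinder/= hist_prefix !in_itv/= => -[hu u1].
  by apply/histP => //; rewrite I_nil.
rewrite !in_itv/= -/(I h u) => hu; have u1 := sub _ hu.
by rewrite /cylinder/= hist_prefix -I_nil; split => //; exact/histP.
Qed.

Let path_at_cylC h : path_at @^-1` cylinder h `&` ~` `[0, 1[%classic =
  if h == nseq (size h) x0 then ~` `[0, 1[%classic else set0.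
Proof.
apply/seteqP; split => u /=.
  rewrite /cylinder/= hist_prefix in_itv/= => -[+ /negP]; rewrite -I_nil => + u1.
  rewrite hist_out// => <-; rewrite size_nseq eqxx /= in_itv /= -I_nil.
  exact/negP.
case: eqP => //= -> ; rewrite in_itv/= => u1; split => //.
by rewrite /cylinder/= size_nseq hist_prefix hist_out// I_nil; exact/negP.
Qed.

Let measurable_path_at :
  measurable_fun setT path_at.
Proof.
have := @measurability _ _ _ _ setT path_at (range (@cylinder M)); apply => //.
move=> _ [_ [h _ <-] <-]; rewrite setTI.
rewrite -[X in measurable X]setIT -(setUv `[0, 1[%classic) setIUr.
rewrite path_at_cyl path_at_cylC; apply: measurableU => //.
by case: ifP => _ //; apply: measurableC.
Qed.

HB.instance Definition _ :=
  isMeasurableFun.Build _ _ _ _ path_at measurable_path_at.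

Lemma path_extension : exists mu : probability (path_space M) R,
  forall h, mu (cylinder h) = (p h)%:E.
Proof.
exists (distribution (@unif01 R) path_at) => h.
transitivity (lebesgue_measure (path_at @^-1` cylinder h `&` `[0, 1[%classic)).
  by [].
rewrite path_at_cyl.
rewrite lebesgue_measure_itv/= lte_fin ltrDl lt_neqAle p_ge0 andbT.
by case: eqP => [<-//|_] /=; rewrite -EFinB addrAC subrr add0r.
Qed.

End extension.

Lemma path_measure_exists (R : realType) (M : mdp) (sch : scheduler R M)
    (s : state M) : exists mu : probability (path_space M) R,
  forall h, mu (cylinder h) = (prefix_prob sch s h)%:E.
Proof.
apply: path_extension => [h||h]; first exact: prefix_prob_ge0.
- by [].
- exact: prefix_prob_sum.
Qed.

(* Uniquely determined by its values on cylinders: see [path_measureE] and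
   [path_measure_unique] below. *)
Definition path_measure (R : realType) (M : mdp) (sch : scheduler R M)
    (s : state M) : probability (path_space M) R :=
  sval (cid (path_measure_exists sch s)).

Lemma path_measureE (R : realType) (M : mdp) (sch : scheduler R M)
    (s : state M) (h : seq (step M)) :
  path_measure sch s (cylinder h) = (prefix_prob sch s h)%:E.
Proof. by rewrite /path_measure; case: cid => mu /= ->. Qed.

Lemma path_measure_unique (R : realType) (M : mdp) (sch : scheduler R M)
    (s : state M) (mu : probability (path_space M) R) :
  (forall h, mu (cylinder h) = (prefix_prob sch s h)%:E) ->
  forall X, measurable X -> mu X = path_measure sch s X.
Proof.
move=> muE X mX; pose C := range (@cylinder M).
pose G : set (set (path_space M)) := C `|` [set set0].
have mG : @measurable _ (path_space M) = <<s G >>.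
  apply/seteqP; split; first by apply: sub_sigma_algebra2; exact: subsetUl.
  apply: smallest_sub; first exact: (sigma_algebra_measurable (path_space M)).
  move=> Y [CY|->]; last exact: measurable0.
  by have := @sub_sigma_algebra _ setT C Y CY.
have CI h1 h2 : (size h1 <= size h2)%N ->
    G (@cylinder M h1 `&` @cylinder M h2).
  move=> h12; have tk w : cylinder h2 w -> prefix_of w (size h1) = take (size h1) h2.
    by rewrite /cylinder/= => <-; rewrite /prefix_of /mkseq -map_take take_iota (minn_idPl h12).
  have [e|ne] := pselect (take (size h1) h2 = h1).
    left; exists h2 => //; apply/seteqP; split => [w h2w|w []//].
    by split => //; rewrite /cylinder/= tk.
  right; apply/seteqP; split => // w [h1w /tk]; rewrite h1w => /esym.
  exact: ne.
apply: (measure_unique G (fun=> setT)) => //.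
- move=> A B [[h1 _ <-]|->]; last by move=> _; right; rewrite set0I.
  move=> [[h2 _ <-]|->]; last by right; rewrite setI0.
  have [h12|/ltnW h21] := leqP (size h1) (size h2); first exact: CI.
  by rewrite setIC; exact: CI.
- by move=> _; left; exists [::] => //; apply/seteqP; split.
- by rewrite bigcup_const.
- move=> Y [[h _ <-]|->]; last by rewrite !measure0.
  exact: etrans (muE h) (esym (path_measureE sch s h)).
- by move=> _; have := probability_setT mu => /= ->; rewrite ltry.
Qed.

Section partial_expectation.
Variables (R : realType) (M : mdp) (goal : state M).

Definition hits (s : state M) (w : inf_path M) (n : nat) : bool :=
  last_state s (prefix_of w n) == goal.

(* As goal is absorbing, the weight accumulated until goal is the weight of
   the prefix ending at the first visit. *)
Definition weight_to_goal (s : state M) (w : inf_path M) : R :=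
  if pselect (exists n, hits s w n) is left e
  then (path_wgt s (prefix_of w (ex_minn e)))%:~R
  else 0.

(* The library evaluates an integral whose positive and negative parts are
   both infinite to -oo, so that schedulers without a well-defined partial
   expectation do not contribute to the supremum. *)
Definition PE (sch : scheduler R M) (s : state M) : \bar R :=
  'E_(path_measure sch s)[weight_to_goal s].

Definition PE_sup (s : state M) : \bar R :=
  ereal_sup [set PE sch s | sch in [set: scheduler R M]].

End partial_expectation.

(* Main.v *)
Require Import Defs.
From mathcomp Require Import all_boot all_order all_algebra.
From mathcomp Require Import all_classical all_reals all_analysis.
From mathcomp Require Import measurable_realfun ring lra zify.

(* Let p(s, w) be the optimal probability of climbing from weight w to a weight
   >= 0 in a state that can still reach goal. By the strong Markov property,
   either p(s, w) decays geometrically as w -> -oo for all s, or p(s, w) = 1 for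
   all w for some s. In the second case one can stay among such states (never
   reaching goal, hence losing nothing) until the weight is as high as wanted and
   only then head for goal, so that the supremum is infinite. In the first case
   H(s, w) = sum_(k >= 1) p(s, w - k) is finite, superharmonic under every
   scheduler, dominates the accumulated weight, and vanishes as w -> -oo.

   For beta < 1, discounting steps by beta gives a value that is attained by a
   weight-based deterministic policy. Let beta -> 1 along an ultrafilter: the
   limit policy agrees with policies for beta arbitrarily close to 1 on any
   bounded window of weights, and H bounds, uniformly in beta, what can be gained
   by leaving the window. So no value is lost in the limit. Discounting is what
   prevents the limit policy from postponing goal forever in zero-weight loops. *)

Set Implicit Arguments.
Unset Strict Implicit.
Unset Printing Implicit Defensive.

Import Order.TTheory GRing.Theory Num.Theory numFieldNormedType.Exports.
Local Open Scope classical_set_scope.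
Local Open Scope ring_scope.

(** * One-step averages and expectations along a scheduler *)

Section one_step.
Variables (R : realType) (M : mdp).
Implicit Types (s t : state M) (a : act M) (w : int) (g : state M -> int -> R).

Definition tprob s a t : R := ratr (trans s a t).

Lemma tprob_ge0 s a t : 0 <= tprob s a t.
Proof. by rewrite /tprob ler0q; have /andP[] := trans_itv s a t. Qed.

Lemma tprob_gt0 s a t : (0 < tprob s a t) = (0 < trans s a t).
Proof. by rewrite /tprob ltr0q. Qed.

Lemma tprob_sum s a : enabled s a -> \sum_t tprob s a t = 1.
Proof. by move=> /eqP e; rewrite /tprob -rmorph_sum /= e rmorph1. Qed.

Definition avg g s w a : R := \sum_t tprob s a t * g t (w + wgt s a).

Lemma avg_le g g' s w w' a :
  (forall t, 0 < trans s a t -> g t (w + wgt s a) <= g' t (w' + wgt s a)) ->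
  avg g s w a <= avg g' s w' a.
Proof.
move=> gg'; apply: ler_sum => t _.
have := tprob_ge0 s a t; rewrite le_eqVlt => /predU1P[<-|p0].
  by rewrite !mul0r.
by rewrite ler_pM2l// gg'// -tprob_gt0.
Qed.

Lemma avg_cst s w a (c : R) : enabled s a -> avg (fun _ _ => c) s w a = c.
Proof. by move=> e; rewrite /avg -mulr_suml tprob_sum// mul1r. Qed.

Lemma avgD g h s w a :
  avg (fun s w => g s w + h s w) s w a = avg g s w a + avg h s w a.
Proof. by rewrite /avg -big_split; apply: eq_bigr => t _ /=; rewrite mulrDr. Qed.

Lemma avgZ g s w a (c : R) :
  avg (fun s w => c * g s w) s w a = c * avg g s w a.
Proof. by rewrite /avg mulr_sumr; apply: eq_bigr => t _ /=; rewrite mulrCA. Qed.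

Lemma avg_ge0 g s w a : (forall t w, 0 <= g t w) -> 0 <= avg g s w a.
Proof. by move=> g0; apply: sumr_ge0 => t _; rewrite mulr_ge0// tprob_ge0. Qed.

Lemma cvg_avg (g : nat -> state M -> int -> R) h s w a :
  (forall t, g n t (w + wgt s a) @[n --> \oo] --> h t (w + wgt s a)) ->
  avg (g n) s w a @[n --> \oo] --> avg h s w a.
Proof.
move=> gh; rewrite /avg.
apply: cvg_big => [|t _]; first exact: add_continuous.
by apply: cvgM => //; exact: cvg_cst.
Qed.

Definition some_act s : act M := xchoose (act_nonempty s).

Lemma some_actP s : enabled s (some_act s).
Proof. exact: xchooseP (act_nonempty s). Qed.

Definition best g s w : act M :=
  [arg max_(a > some_act s | enabled s a) avg g s w a]%O.

Lemma bestP g s w : enabled s (best g s w).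
Proof. by rewrite /best; case: arg_maxP => //; exact: some_actP. Qed.

Lemma best_ge g s w a : enabled s a -> avg g s w a <= avg g s w (best g s w).
Proof.
move=> e; rewrite /best; case: arg_maxP => [|b _]; first exact: some_actP.
exact.
Qed.

End one_step.

Section scheduled.
Variables (R : realType) (M : mdp).
Implicit Types (sch : scheduler R M) (s t : state M) (a : act M) (w : int).
Implicit Types (g : state M -> int -> R) (F : seq (step M) -> R).

(** General schedulers see the whole history, so the one-step operator acts on functions of
    histories. Its [n]-th iterate at [h] is the conditional expectation of [F] evaluated [n] steps
    after [h]. *)
Definition next sch s F h : R :=
  \sum_a sch s h a * \sum_t tprob R (last_state s h) a t * F (rcons h (a, t)).

Definition at_end s w g h : R := g (last_state s h) (w + path_wgt s h).

Definition expect sch s w n g : R := iter n (next sch s) (at_end s w g) [::].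

Lemma path_wgt_rcons s h a t :
  path_wgt s (rcons h (a, t)) = path_wgt s h + wgt (last_state s h) a.
Proof.
elim: h s => [|[b u] h IH] s /=; first by rewrite addr0 add0r.
by rewrite IH addrA.
Qed.

Lemma next_at_end sch s w g h : next sch s (at_end s w g) h =
  \sum_a sch s h a * avg g (last_state s h) (w + path_wgt s h) a.
Proof.
apply: eq_bigr => a _; congr (_ * _); apply: eq_bigr => t _.
by rewrite /at_end last_state_rcons path_wgt_rcons addrA.
Qed.

Lemma next_le sch s F G h : is_path s h ->
  (forall h, is_path s h -> F h <= G h) -> next sch s F h <= next sch s G h.
Proof.
move=> hp FG; apply: ler_sum => a _.
apply: ler_wpM2l; first exact: choose_act_ge0.
apply: ler_sum => t _; have := tprob_ge0 R (last_state s h) a t.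
rewrite le_eqVlt => /predU1P[<-|p0]; first by rewrite !mul0r.
by rewrite ler_pM2l// FG// is_path_rcons hp -(tprob_gt0 R).
Qed.

Lemma iter_next_le sch s n F G h : is_path s h ->
  (forall h, is_path s h -> F h <= G h) ->
  iter n (next sch s) F h <= iter n (next sch s) G h.
Proof.
by move=> + FG; elim: n h => [|n IH] h hp; [exact: FG | exact: next_le].
Qed.

Lemma iter_next_lin sch s n F G h (c d : R) :
  iter n (next sch s) (fun h => c * F h + d * G h) h =
  c * iter n (next sch s) F h + d * iter n (next sch s) G h.
Proof.
elim: n h => [//|n IH] h /=; rewrite /next !mulr_sumr -big_split.
apply: eq_bigr => a _ /=; rewrite mulrCA [d * _]mulrCA -mulrDr; congr (_ * _).
rewrite !mulr_sumr -big_split; apply: eq_bigr => t _ /=.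
rewrite IH; ring.
Qed.

Lemma expect_le sch s w n g g' :
  (forall s w, g s w <= g' s w) -> expect sch s w n g <= expect sch s w n g'.
Proof. by move=> gg'; apply: iter_next_le => // h _; exact: gg'. Qed.

Lemma expect_lin sch s w n g g' (c d : R) :
  expect sch s w n (fun s w => c * g s w + d * g' s w) =
  c * expect sch s w n g + d * expect sch s w n g'.
Proof. exact: iter_next_lin. Qed.

Lemma expect0 sch s w g : expect sch s w 0 g = g s w.
Proof. by rewrite /expect /at_end /= addr0. Qed.

Lemma weighted_le sch s h (f : act M -> R) c : is_path s h ->
  (forall a, enabled (last_state s h) a -> f a <= c) ->
  \sum_a sch s h a * f a <= c.
Proof.
move=> hp fc; rewrite -[leRHS]mul1r -(choose_act_sum sch hp) mulr_suml.
apply: ler_sum => a _.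
have [e|ne] := boolP (enabled (last_state s h) a); last first.
  by rewrite choose_act_enabled// !mul0r.
by rewrite ler_wpM2l ?fc// choose_act_ge0.
Qed.

Lemma weighted_ge sch s h (f : act M -> R) c : is_path s h ->
  (forall a, enabled (last_state s h) a -> c <= f a) ->
  c <= \sum_a sch s h a * f a.
Proof.
move=> hp fc; rewrite -lerN2 -sumrN; under eq_bigr do rewrite -mulrN.
by apply: weighted_le => // a e; rewrite lerN2 fc.
Qed.

(** The choice [g' = g] gives the supermartingale property; value iteration takes for [g'] the best
    one-step average of [g]. *)
Lemma expect_super sch s w n g g' :
  (forall s w a, enabled s a -> avg g s w a <= g' s w) ->
  expect sch s w n.+1 g <= expect sch s w n g'.
Proof.
move=> H; rewrite /expect iterSr; apply: iter_next_le => // h hp.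
by rewrite next_at_end; apply: weighted_le => // a e; exact: H.
Qed.

Lemma expect_sub sch s w n g g' :
  (forall s w a, enabled s a -> g' s w <= avg g s w a) ->
  expect sch s w n g' <= expect sch s w n.+1 g.
Proof.
move=> H; rewrite /expect iterSr; apply: iter_next_le => // h hp.
by rewrite next_at_end; apply: weighted_ge => // a e; exact: H.
Qed.

Lemma expect_ge0 sch s w n g : (forall s w, 0 <= g s w) ->
  0 <= expect sch s w n g.
Proof.
move=> g0; have -> : 0 = expect sch s w n (fun s w => 0 * g s w + 0 * g s w).
  by rewrite expect_lin !mul0r addr0.
by apply: expect_le => t v; rewrite !mul0r addr0.
Qed.

End scheduled.

(** * Weight-based deterministic schedulers from policies *)

Section stationary.
Variables (R : realType) (M : mdp) (pi : state M -> int -> act M).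
Hypothesis piE : forall s w, enabled s (pi s w).

Let choose s h a : R := (a == pi (last_state s h) (path_wgt s h))%:R.

Let choose_ge0 s h a : is_path s h -> 0 <= choose s h a.
Proof. by []. Qed.

Let choose_sum s h : is_path s h -> \sum_a choose s h a = 1.
Proof.
by rewrite (bigD1 (pi (last_state s h) (path_wgt s h)))//= /choose eqxx
  big1 ?addr0// => a /negbTE->.
Qed.

Let choose_enabled s h a : is_path s h -> ~~ enabled (last_state s h) a ->
  choose s h a = 0.
Proof.
move=> _; rewrite /choose; case: eqP => //= ->.
by rewrite piE.
Qed.

Definition stationary : scheduler R M :=
  Scheduler choose_ge0 choose_sum choose_enabled.

Lemma stationary_deterministic : deterministic stationary.
Proof.
by move=> s h _; exists (pi (last_state s h) (path_wgt s h)); rewrite /= /choose eqxx.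
Qed.

Lemma stationary_weight_based : weight_based stationary.
Proof. by move=> s h s' h' _ _ e1 e2 a; rewrite /= /choose e1 e2. Qed.

(** The initial weight is 0 because the scheduler reads [path_wgt], which only then is the weight
    that [g] sees. *)
Lemma expect_stationary s n g : expect stationary s 0 n.+1 g =
  expect stationary s 0 n (fun s w => avg g s w (pi s w)).
Proof.
rewrite /expect iterSr; elim: n [::] => [|n IH] h; last first.
  by apply: eq_bigr => a _; congr (_ * _); apply: eq_bigr => t _; congr (_ * _); exact: IH.
rewrite /= next_at_end (bigD1 (pi (last_state s h) (path_wgt s h)))//=.
rewrite {1}/choose eqxx mul1r big1 ?addr0 /at_end ?add0r//.
by move=> a /negbTE ane; rewrite /choose ane mul0r.
Qed.

End stationary.

(** * Values that a single scheduler can guarantee *)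

(** Capping the minimum by 1 covers an empty index set and keeps [q] usable as a probability. *)
Lemma finite_lower_bound (R : realType) (I : finType) (P : pred I) (F : I -> R) :
  (forall i, P i -> 0 < F i) ->
  exists q : R, [/\ 0 < q, q <= 1 & forall i, P i -> q <= F i].
Proof.
move=> F0; exists (\big[Num.min/1]_(i | P i) F i); split.
- exact: lt_bigmin.
- exact: bigmin_le_id.
- by move=> i Pi; exact: bigmin_le_cond.
Qed.

Section weights.
Variables (R : realType) (M : mdp).

Definition max_wgt : nat := \max_(x : state M * act M) `|wgt x.1 x.2|%N.

Lemma wgt_bound (s : state M) a : - max_wgt%:Z <= wgt s a <= max_wgt%:Z.
Proof.
rewrite -ler_norml -abszE lez_nat /max_wgt.
exact: (@leq_bigmax _ (fun x : state M * act M => `|wgt x.1 x.2|%N) (s, a)).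
Qed.

Lemma wgt_boundR (s : state M) a :
  - max_wgt%:R <= ((wgt s a)%:~R : R) <= max_wgt%:R.
Proof.
have := wgt_bound s a.
by rewrite -!(ler_int R) rmorphN.
Qed.

Lemma trans_enabled (s : state M) a t : 0 < trans s a t -> enabled s a.
Proof.
move=> p0; rewrite /enabled; have [e|->//] := trans_sum s a.
have : trans s a t <= 0.
  rewrite -e (bigD1 t)//= lerDl; apply: sumr_ge0 => u _.
  by have /andP[] := trans_itv s a u.
by rewrite leNgt p0.
Qed.

Lemma avg_absorbing (g : state M -> int -> R) s w a :
  absorbing s -> enabled s a -> avg g s w a = g s w.
Proof.
move=> [b [_ uniq_b tb wb]] /[dup] ea /uniq_b ab; subst b.
rewrite /avg (bigD1 s)//= wb addr0 {1}/tprob tb rmorph1 mul1r big1 ?addr0//.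
move=> t ts; suff -> : tprob R s a t = 0 by rewrite mul0r.
(* The loop already carries the whole mass 1. *)
apply/eqP; rewrite eq_le tprob_ge0 andbT -(lerD2l 1) addr0.
rewrite -[leRHS](tprob_sum R ea) (bigD1 s)//= {2}/tprob tb rmorph1 lerD2l.
rewrite (bigD1 t)//= lerDl.
by apply: sumr_ge0 => u _; exact: tprob_ge0.
Qed.

End weights.

Section composition.
Variables (R : realType) (M : mdp) (s0 : state M) (a0 : act M).
Variable f : state M -> scheduler R M.
Hypothesis ea0 : enabled s0 a0.

(** After a first step to [t], the scheduler [f t] takes over as if the path had started in [t].
    From initial states other than [s0], [f s] merely supplies legal choices. *)
Let choose s h a : R :=
  if s == s0 then if h is (b, t) :: h' then f t t h' a else (a == a0)%:R
  else f s s h a.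

Let choose_ge0 s h a : is_path s h -> 0 <= choose s h a.
Proof.
rewrite /choose; case: eqP => [->|_ hp]; last exact: choose_act_ge0.
by case: h => [//|[b t] h /andP[_ hp]]; exact: choose_act_ge0.
Qed.

Let choose_sum s h : is_path s h -> \sum_a choose s h a = 1.
Proof.
rewrite /choose; case: eqP => [->|_ hp]; last exact: choose_act_sum.
case: h => [_|[b t] h /andP[_ hp]]; last exact: choose_act_sum.
by rewrite (bigD1 a0)//= eqxx big1 ?addr0// => a /negbTE->.
Qed.

Let choose_enabled s h a : is_path s h -> ~~ enabled (last_state s h) a ->
  choose s h a = 0.
Proof.
rewrite /choose; case: eqP => [->|_ hp]; last exact: choose_act_enabled.
case: h => [_|[b t] h /andP[_ hp] ne]; last exact: (choose_act_enabled _ hp ne).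
by case: eqP => // ->; rewrite /last_state /= ea0.
Qed.

Definition compose : scheduler R M :=
  Scheduler choose_ge0 choose_sum choose_enabled.

Let iter_next_cons n F a t h : iter n (next compose s0) F ((a, t) :: h) =
  iter n (next (f t) t) (F \o cons (a, t)) h.
Proof.
elim: n h => [//|n IH] h /=; rewrite {1}/next.
apply: eq_bigr => b _; rewrite /= /choose eqxx; congr (_ * _).
by apply: eq_bigr => u _; congr (_ * _); exact: IH.
Qed.

Lemma expect_compose w n (g : state M -> int -> R) :
  expect compose s0 w n.+1 g =
  avg (fun t w' => expect (f t) t w' n g) s0 w a0.
Proof.
rewrite /expect /= {1}/next (bigD1 a0)//= [X in _ + X]big1 ?addr0 => [|a ane]; last first.
  by rewrite /choose eqxx (negbTE ane) mul0r.
  rewrite /choose !eqxx mul1r; apply: eq_bigr => t _; congr (_ * _).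
  rewrite iter_next_cons; congr (iter n _ _ _); apply/funext => h.
  by rewrite /at_end /= addrA.
Qed.

End composition.

Section achievable.
Variables (R : realType) (M : mdp) (goal : state M).
Hypothesis goal_absorbing : absorbing goal.
Hypothesis collapsed : fail_collapsed goal.
Implicit Types (s t : state M) (w : int).

(** The positive and negative parts of the payoff are kept apart: each has nondecreasing
    expectations, so each has a limit in the extended reals. *)
Definition gain s w : R := if s == goal then Num.max w%:~R 0 else 0.
Definition loss s w : R := if s == goal then Num.max (- w%:~R) 0 else 0.

Lemma gainE s w : gain s w = if s == goal then Num.max w%:~R 0 else 0.
Proof. by []. Qed.

Lemma lossE s w : loss s w = if s == goal then Num.max (- w%:~R) 0 else 0.
Proof. by []. Qed.

Lemma gain_ge0 s w : 0 <= gain s w.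
Proof. by rewrite /gain; case: eqP => // _; rewrite le_max lexx orbT. Qed.

Lemma loss_ge0 s w : 0 <= loss s w.
Proof. by rewrite /loss; case: eqP => // _; rewrite le_max lexx orbT. Qed.

(** A gain once collected stays, as [goal] is absorbing; elsewhere [gain] vanishes. *)
Lemma gain_sub s w a : enabled s a -> gain s w <= avg gain s w a.
Proof.
move=> e; have [sg|sg] := eqVneq s goal.
  by rewrite avg_absorbing// sg.
rewrite {1}/gain (negbTE sg); apply: avg_ge0; exact: gain_ge0.
Qed.

Lemma loss_sub s w a : enabled s a -> loss s w <= avg loss s w a.
Proof.
move=> e; have [sg|sg] := eqVneq s goal.
  by rewrite avg_absorbing// sg.
rewrite {1}/loss (negbTE sg); apply: avg_ge0; exact: loss_ge0.
Qed.

Lemma expect_gain_nd (sch : scheduler R M) s w :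
  {homo (fun n => expect sch s w n gain) : m n / (m <= n)%N >-> m <= n}.
Proof.
by apply: homo_leq => [//|x y z|n]; [exact: le_trans | apply: expect_sub; exact: gain_sub].
Qed.

Lemma expect_loss_nd (sch : scheduler R M) s w :
  {homo (fun n => expect sch s w n loss) : m n / (m <= n)%N >-> m <= n}.
Proof.
by apply: homo_leq => [//|x y z|n]; [exact: le_trans | apply: expect_sub; exact: loss_sub].
Qed.

(* Gains are counted at one finite time but losses over the whole run, so v is a
   lower bound for the partial expectation whether or not that is finite. *)
Definition achievable s w (v : R) : Prop :=
  exists (sch : scheduler R M) (N : nat) (C : R),
    (forall n, expect sch s w n loss <= C) /\ v <= expect sch s w N gain - C.

Lemma achievable_le s w v v' : v' <= v -> achievable s w v -> achievable s w v'.
Proof.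
move=> vv' [sch [N [C [hC hv]]]]; exists sch, N, C; split => //.
exact: le_trans hv.
Qed.

(** Take [a] first and then the witness for the state reached. Since expected gains never decrease
    with time, the largest of the finitely many horizons serves all successors; the loss bounds are
    averaged. *)
Lemma achievable_step s w a (v : state M -> R) : enabled s a ->
  (forall t, 0 < trans s a t -> achievable t (w + wgt s a) (v t)) ->
  achievable s w (\sum_t tprob R s a t * v t).
Proof.
move=> ea av.
have /choice[f fP] : forall t, exists x : scheduler R M * nat * R, 0 < trans s a t ->
    (forall n, expect x.1.1 t (w + wgt s a) n loss <= x.2) /\
    v t <= expect x.1.1 t (w + wgt s a) x.1.2 gain - x.2.
  move=> t; have [/av[sch [N [C H]]]|_] := boolP (0 < trans s a t).
    by exists (sch, N, C).
  by exists (stationary R (fun s' _ => some_actP s'), 0%N, 0).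
pose N := \max_t (f t).1.2.
pose sch := compose (fun t => (f t).1.1) ea.
exists sch, N.+1, (\sum_t tprob R s a t * (f t).2); split.
  move=> n; apply: (le_trans (expect_loss_nd sch s w (leqnSn n))).
  rewrite expect_compose.
  apply: (@avg_le _ _ _ (fun t _ => (f t).2) _ w w) => t pt.
  by have [->] := fP _ pt.
rewrite expect_compose -sumrB; apply: ler_sum => t _.
have := tprob_ge0 R s a t; rewrite le_eqVlt => /predU1P[<-|p0].
  by rewrite !mul0r subrr.
rewrite -mulrBr ler_pM2l//; have [|_ h] := fP t; first by rewrite -(tprob_gt0 R).
apply: le_trans h _; rewrite lerD2r; apply: expect_gain_nd.
exact: (@leq_bigmax _ (fun t => (f t).1.2)).
Qed.

(** The rank is the length of a shortest path to [goal], which drops along the first step of such a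
    path. *)
Lemma goal_rank : exists d : state M -> nat,
  forall s, reachable s goal -> s != goal ->
    exists a t, 0 < trans s a t /\ (d t < d s)%N.
Proof.
pose P s n := `[< exists h, [/\ size h = n, is_path s h & last_state s h = goal] >].
pose d s := if pselect (exists n, P s n) is left e then ex_minn e else 0%N.
have dle s n : P s n -> (d s <= n)%N.
  rewrite /d; case: pselect => [e Pn|ne Pn]; last by case: ne; exists n.
  by case: ex_minnP => m _; exact.
have dP s : reachable s goal -> P s (d s).
  move=> [h [hp hl]]; rewrite /d; case: pselect => [e|[]].
    by case: ex_minnP.
  by exists (size h); apply/asboolP; exists h.
exists d => s /dP/asboolP[[|[a t] h] [hs hp hl] sg].
  by rewrite -hl /last_state /= eqxx in sg.
exists a, t; move: hp => /= /andP[p0 hp]; split => //.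
rewrite -hs ltnS; apply: dle; apply/asboolP; exists h; split => //.
Qed.

(** Under the policy [tau], which moves towards [goal], a bounded function [e] of the state grows by
    at least 1 in expectation per step outside absorbing states. One step raises the negative part
    of the weight by at most [W], so subtracting [W * e] compensates. *)
Lemma loss_potential : exists (tau : state M -> act M) (pot : state M -> int -> R)
    (C : R), [/\ forall s, enabled s (tau s), 0 <= C,
    forall s w, avg pot s w (tau s) <= pot s w,
    forall s w, Num.max (- w%:~R) 0 <= pot s w &
    forall s w, pot s w <= Num.max (- w%:~R) 0 + C].
Proof.
have [d dP] := goal_rank.
have [q [q0 q1 qP]] := @finite_lower_bound R _
  (fun x : state M * act M * state M => 0 < trans x.1.1 x.1.2 x.2)
  (fun x => tprob R x.1.1 x.1.2 x.2) (fun x => etrans (tprob_gt0 R _ _ _)).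
pose N := \max_s d s; have dN s : (d s <= N)%N by exact: (@leq_bigmax _ d).
(* A rank-decreasing step has probability at least [q] and multiplies [e] by at least [y], so the
   average of [e] is at least [q * y * e s = 2 * e s >= e s + 1]. *)
pose y := 2 / q.
have y1 : 1 <= y by rewrite /y ler_pdivlMr// mul1r (le_trans q1)// ler1n.
pose e s := y ^+ (N - d s).
have e1 s : 1 <= e s by exact: exprn_ege1.
have eN s : e s <= y ^+ N by apply: ler_weXn2l => //; rewrite leq_subr.
have /choice[tau tauP] : forall s, exists a, enabled s a /\
    (absorbing s \/ e s + 1 <= \sum_t tprob R s a t * e t).
  move=> s; have [rs|nrs] := pselect (reachable s goal); last first.
    by exists (some_act s); split; [exact: some_actP|left; have [] := collapsed nrs].
  have [->|sg] := eqVneq s goal.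
    by exists (some_act goal); split; [exact: some_actP|left].
  have [a [t [p0 dt]]] := dP s rs sg.
  exists a; split; first exact: trans_enabled p0.
  right; rewrite (bigD1 t)//= -[leLHS]addr0; apply: lerD; last first.
    apply: sumr_ge0 => u _; rewrite mulr_ge0 ?tprob_ge0//.
    exact: le_trans (e1 u).
  apply: (@le_trans _ _ (q * y ^+ (N - d s).+1)).
    rewrite exprS mulrA /y mulrCA divff ?gt_eqF// mulr1 -/y.
    by have := e1 s; rewrite /e; lra.
  apply: ler_pM => //; first by rewrite ltW.
  - by rewrite exprn_ge0// (le_trans _ y1).
  - exact: (qP (s, a, t)).
  - by apply: ler_weXn2l => //; have := dN s; lia.
pose W : R := (max_wgt M)%:R; have W0 : 0 <= W by [].
exists tau, (fun s w => Num.max (- w%:~R) 0 + W * (y ^+ N - e s)), (W * y ^+ N).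
split.
- by move=> s; have [] := tauP s.
- by rewrite mulr_ge0// exprn_ge0// (le_trans _ y1).
- move=> s w; have [ea [ab|sub]] := tauP s; first by rewrite avg_absorbing.
  have -> : Num.max (- w%:~R) 0 + W * (y ^+ N - e s) =
      (Num.max (- w%:~R) 0 + W + W * y ^+ N) + (- W) * (e s + 1) by ring.
  apply: (@le_trans _ _ (avg (fun t _ => (Num.max (- w%:~R) 0 + W + W * y ^+ N) +
     (- W) * e t) s w (tau s))).
    apply: avg_le => t _; have /andP[wl wu] := wgt_boundR R s (tau s).
    have : Num.max (- (w + wgt s (tau s))%:~R) 0 <= Num.max (- (w%:~R : R)) 0 + W.
      rewrite intrD ge_max; apply/andP; split; last first.
        by rewrite addr_ge0// le_max lexx orbT.
      rewrite opprD; apply: lerD; last by rewrite lerNl.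
      by rewrite le_max lexx.
    lra.
  rewrite avgD avg_cst// avgZ lerD2l.
  by apply: ler_wnM2l; rewrite ?oppr_le0.
- by move=> s w; rewrite lerDl mulr_ge0// subr_ge0.
- move=> s w; rewrite lerD2l ler_wpM2l// gerBl.
  exact: le_trans (e1 s).
Qed.

Lemma memoryless_super (tau : state M -> act M) (etau : forall s, enabled s (tau s))
    (pot : state M -> int -> R) :
  (forall s w, avg pot s w (tau s) <= pot s w) ->
  forall s w n, expect (stationary R (fun s (_ : int) => etau s)) s w n pot <= pot s w.
Proof.
move=> sup s w; elim=> [|n IH]; first by rewrite expect0.
apply: le_trans IH; rewrite /expect iterSr; apply: iter_next_le => // h hp.
rewrite next_at_end (bigD1 (tau (last_state s h)))//= eqxx mul1r.
by rewrite big1 ?addr0// => a /negbTE->; rewrite mul0r.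
Qed.

Lemma achievable_low : exists C : R, 0 <= C /\
  forall s w, achievable s w (- (Num.max (- w%:~R) 0 + C)).
Proof.
have [tau [pot [C [etau C0 sup lpot potC]]]] := loss_potential.
exists C; split => // s w.
exists (stationary R (fun s (_ : int) => etau s)), 0%N, (pot s w); split.
  move=> n; apply: le_trans (memoryless_super etau sup s w n).
  apply: expect_le => t v; apply: le_trans (lpot t v).
  by rewrite /loss; case: eqP => // _; rewrite le_max lexx orbT.
have := expect_ge0 (stationary R (fun s (_ : int) => etau s)) s w 0 gain_ge0.
by have := potC s w; lra.
Qed.

(** A run that stays in [A] never meets [goal] and so loses nothing. Outside [A] the policy [tau]
    and its potential are used, so that [D] is superharmonic at every state. *)
Lemma achievable_avoid (A : pred (state M)) (stay : state M -> act M) :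
  goal \notin A ->
  (forall s, s \in A -> enabled s (stay s) /\
    forall t, 0 < trans s (stay s) t -> t \in A) ->
  forall s w, s \in A -> achievable s w 0.
Proof.
move=> gA stayP s w sA.
have [tau [pot [C [etau C0 sup lpot _]]]] := loss_potential.
pose pi s := if s \in A then stay s else tau s.
have epi t : enabled t (pi t).
  by rewrite /pi; case: ifP => // /stayP[].
pose D t v := if t \in A then 0 else pot t v.
have pot0 t v : 0 <= pot t v.
  by apply: le_trans (lpot t v); rewrite le_max lexx orbT.
have Dsup t v : avg D t v (pi t) <= D t v.
  rewrite /pi {2}/D; case: ifPn => tA.
    rewrite -(avg_cst v 0 (stayP _ tA).1); apply: avg_le => u /(stayP _ tA).2 uA.
    by rewrite /D uA.
  apply: le_trans (sup t v); apply: avg_le => u _.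
  by rewrite /D; case: ifP.
exists (stationary R (fun s (_ : int) => epi s)), 0%N, 0; split.
  move=> n; have := memoryless_super epi Dsup s w n.
  rewrite {2}/D sA; apply: le_trans; apply: expect_le => t v.
  rewrite /loss /D; case: eqP => [->|_]; last by case: ifP.
  by rewrite (negbTE gA); exact: lpot.
by rewrite subr0; apply: expect_ge0; exact: gain_ge0.
Qed.

Lemma path_from_goal h : is_path goal h ->
  last_state goal h = goal /\ path_wgt goal h = 0.
Proof.
elim: h => [//|[a t] h IH] /andP[p0 hp].
have [b [eb ub tb wb]] := goal_absorbing.
have ea := trans_enabled p0; have ab := ub _ ea; subst b.
have [tg|tg] := eqVneq t goal; first by subst t; rewrite /= wb add0r; exact: IH.
(* Averaging the indicator of [t] shows that the step from [goal] to [t] has probability 0. *)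
have := avg_absorbing (fun s _ => (s == t)%:R : R) 0 goal_absorbing ea.
rewrite /avg (bigD1 t)//= eqxx mulr1 big1 ?addr0.
  by rewrite eq_sym (negbTE tg) => p0'; move: p0; rewrite -(tprob_gt0 R) p0' ltxx.
by move=> u /negbTE->; rewrite mulr0.
Qed.

Lemma achievable_goal w : achievable goal w w%:~R.
Proof.
pose sch := stationary R (fun s (_ : int) => @some_actP M s).
have H g n : expect sch goal w n g = g goal w.
  suff : forall h, is_path goal h ->
      iter n (next sch goal) (at_end goal w g) h = g goal w by exact.
  elim: n => [|n IH] h hp /=.
    by have [e1 e2] := path_from_goal hp; rewrite /at_end e1 e2 addr0.
  rewrite -[RHS]mul1r -(choose_act_sum sch hp) mulr_suml.
  apply: eq_bigr => a _.
  have [e|ne] := boolP (enabled (last_state goal h) a); last first.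
    by rewrite choose_act_enabled// !mul0r.
  congr (_ * _); rewrite -[RHS]mul1r -(tprob_sum R e) mulr_suml.
  apply: eq_bigr => t _; have := tprob_ge0 R (last_state goal h) a t.
  rewrite le_eqVlt => /predU1P[<-|p0]; first by rewrite !mul0r.
  by rewrite IH// is_path_rcons hp -(tprob_gt0 R).
exists sch, 0%N, (loss goal w); split => [n|]; rewrite H//.
rewrite /gain /loss eqxx; have [w0|w0] := leP (w%:~R : R) 0.
  by rewrite max_l ?oppr_ge0// sub0r opprK.
by rewrite max_r ?oppr_le0 ?subr0// ltW.
Qed.

(** Try to follow [h] and, on leaving it, fall back on [achievable_low]. With the actions of [h]
    fixed, [p] is the probability of [h]; each step adds [C0 + W] to the cost. *)
Lemma achievable_path s h : is_path s h -> exists p C : R, [/\ 0 < p, 0 <= C &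
  forall w v, achievable (last_state s h) (w + path_wgt s h) v ->
    achievable s w (p * v - C - Num.max (- w%:~R) 0)].
Proof.
have [C0 [C00 low]] := achievable_low.
elim: h s => [|[a t] h IH] s.
  exists 1, 0; split=> // w v; rewrite /= addr0 mul1r subr0.
  by apply: achievable_le; rewrite gerBl le_max lexx orbT.
move=> /= /andP[p0 hp]; have [p [C [pp CC H]]] := IH _ hp.
have ea := trans_enabled p0; rewrite -(tprob_gt0 R) in p0.
pose W : R := (max_wgt M)%:R; have W0 : 0 <= W by [].
exists (tprob R s a t * p), (C + C0 + W); split.
- exact: mulr_gt0.
- by rewrite !addr_ge0.
move=> w v; rewrite addrA => /H hv.
have -> : tprob R s a t * p * v - (C + C0 + W) - Num.max (- w%:~R) 0 =
  \sum_u tprob R s a u * ((u == t)%:R * (p * v) - (C + C0 + W) - Num.max (- w%:~R) 0).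
  under eq_bigr do rewrite -addrA mulrDr; rewrite big_split /= -mulr_suml tprob_sum//.
  rewrite mul1r -addrA; congr (_ + _).
  rewrite (bigD1 t)//= eqxx mul1r mulrA big1 ?addr0// => u /negbTE->.
  by rewrite mul0r mulr0.
apply: achievable_step => // u _.
have mw : Num.max (- (w + wgt s a)%:~R) 0 <= Num.max (- (w%:~R : R)) 0 + W.
  have /andP[wl wu] := wgt_boundR R s a.
  rewrite intrD ge_max; apply/andP; split; last first.
    by rewrite addr_ge0// le_max lexx orbT.
  rewrite opprD; apply: lerD; last by rewrite lerNl.
  by rewrite le_max lexx.
case: eqP => [->|_].
  by apply: achievable_le hv; rewrite mul1r; lra.
by apply: achievable_le (low u (w + wgt s a)); rewrite mul0r; lra.
Qed.

End achievable.

(** * Climbing to high weights *)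

Section hitting.
Variables (R : realType) (M : mdp) (goal : state M).
Hypothesis goal_absorbing : absorbing goal.
Hypothesis collapsed : fail_collapsed goal.
Implicit Types (s t : state M) (w : int).

Definition live s : bool := `[< reachable s goal >].

(* Optimal probability of being, within n steps, in a live state with weight >= 0.
   Climbing from w to another level k is hit at w - k. *)
Fixpoint hit n s w : R :=
  if live s && (0 <= w) then 1
  else if n is m.+1 then avg (hit m) s w (best (hit m) s w) else 0.

Lemma hit_stop n s w : live s -> 0 <= w -> hit n s w = 1.
Proof. by case: n => [|n] /= -> ->. Qed.

Lemma hit_ge0 n s w : 0 <= hit n s w.
Proof. by elim: n s w => [|n IH] s w /=; case: ifP => // _; exact: avg_ge0. Qed.

Lemma hit_le1 n s w : hit n s w <= 1.
Proof.
elim: n s w => [|n IH] s w /=; case: ifP => // _.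
rewrite -[leRHS](avg_cst w 1 (bestP (hit n) s w)).
by apply: avg_le => t _.
Qed.

Lemma hit_ndS n s w : hit n s w <= hit n.+1 s w.
Proof.
elim: n s w => [|n IH] s w /=; case: ifP => // _; first by apply: avg_ge0 => t v; exact: (hit_ge0 0 t v).
apply: le_trans (best_ge _ _ (bestP (hit n) s w)).
by apply: avg_le => t _; exact: IH.
Qed.

Lemma hit_nd s w : nondecreasing_seq (fun n => hit n s w).
Proof. by apply/nondecreasing_seqP => n; exact: hit_ndS. Qed.

Lemma hit_mono n s w w' : w <= w' -> hit n s w <= hit n s w'.
Proof.
elim: n s w w' => [|n IH] s w w' ww' /=.
  by case: ifPn => [/andP[-> w0]|_]; [rewrite (le_trans w0) | case: ifP].
case: ifPn => [/andP[-> w0]|_]; first by rewrite (le_trans w0).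
case: ifP => _.
  rewrite -[leRHS](avg_cst w 1 (bestP (hit n) s w)).
  by apply: avg_le => t _; exact: hit_le1.
apply: le_trans (best_ge _ _ (bestP (hit n) s w)).
by apply: avg_le => t _; apply: IH; rewrite lerD2r.
Qed.

Lemma hit_dead n s w : ~~ live s -> hit n s w = 0.
Proof.
move=> /[dup] ns /asboolPn/collapsed[ab _].
elim: n w => [|n IH] w /=; rewrite (negbTE ns)//=.
by rewrite avg_absorbing ?IH//; exact: bestP.
Qed.

Lemma hit_goal n w : w < 0 -> hit n goal w = 0.
Proof.
move=> w0; elim: n => [|n IH] /=; rewrite leNgt w0 andbF//=.
by rewrite avg_absorbing ?IH//; exact: bestP.
Qed.

Definition hit_lim s w : R := limn (fun n => hit n s w).

Lemma cvg_hit s w : hit n s w @[n --> \oo] --> hit_lim s w.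
Proof.
apply: nondecreasing_is_cvgn; first exact: hit_nd.
by exists 1 => _ [n _ <-]; exact: hit_le1.
Qed.

Lemma hit_le_lim n s w : hit n s w <= hit_lim s w.
Proof. apply: nondecreasing_cvgn_le; [exact: hit_nd|by apply: cvgP; exact: cvg_hit]. Qed.

Lemma hit_lim_le s w c : (forall n, hit n s w <= c) -> hit_lim s w <= c.
Proof.
move=> hc; apply: limr_le; first by apply: cvgP; exact: cvg_hit.
by near=> n; exact: hc.
Unshelve. all: by end_near. Qed.

Lemma hit_lim_ge0 s w : 0 <= hit_lim s w.
Proof. exact: le_trans (hit_ge0 0 s w) (hit_le_lim _ _ _). Qed.

Lemma hit_lim_le1 s w : hit_lim s w <= 1.
Proof. by apply: hit_lim_le => n; exact: hit_le1. Qed.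

Lemma hit_lim_mono s w w' : w <= w' -> hit_lim s w <= hit_lim s w'.
Proof.
move=> ww'; apply: hit_lim_le => n.
exact: le_trans (hit_mono n s ww') (hit_le_lim _ _ _).
Qed.

Lemma hit_lim_stop s w : live s -> 0 <= w -> hit_lim s w = 1.
Proof.
move=> ls w0; apply/eqP; rewrite eq_le hit_lim_le1/=.
by rewrite -(hit_stop 0 ls w0) hit_le_lim.
Qed.

Lemma hit_lim_dead s w : ~~ live s -> hit_lim s w = 0.
Proof.
move=> ls; apply/eqP; rewrite eq_le hit_lim_ge0 andbT.
by apply: hit_lim_le => n; rewrite hit_dead.
Qed.

(** Superharmonicity passes to the limit even if the average of each approximant is only bounded by
    some other approximant. *)
Lemma avg_limit_le (g : nat -> state M -> int -> R) h s w a :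
  (forall t w, g n t w @[n --> \oo] --> h t w) ->
  (forall n t w, g n t w <= h t w) ->
  (forall n, exists m, avg (g n) s w a <= g m s w) ->
  avg h s w a <= h s w.
Proof.
move=> gh gleh sup.
have cv : avg (g n) s w a @[n --> \oo] --> avg h s w a by exact: cvg_avg.
rewrite -(cvg_lim (@Rhausdorff R) cv); apply: limr_le; first by apply: cvgP; exact: cv.
by near=> n; have [m le] := sup n; exact: le_trans le (gleh m s w).
Unshelve. all: by end_near. Qed.

Lemma hit_lim_super s w a : enabled s a -> avg hit_lim s w a <= hit_lim s w.
Proof.
move=> ea; apply: (avg_limit_le (g := hit)) => [t v|n t v|n].
- exact: cvg_hit.
- exact: hit_le_lim.
exists n.+1 => /=; case: ifP => _; last exact: best_ge.
by rewrite -[leRHS](avg_cst w 1 ea); apply: avg_le => t _; exact: hit_le1.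
Qed.

(** By translation of weights, such a state allows a climb of any height with probability
    arbitrarily close to 1. *)
Definition unbounded s : bool := `[< forall w, hit_lim s w = 1 >].

Lemma bounded_depth : exists k : state M -> nat,
  forall s, ~~ unbounded s -> hit_lim s (- (k s)%:Z) < 1.
Proof.
suff /choice[k kP] : forall s, exists k : nat, ~~ unbounded s -> hit_lim s (- k%:Z) < 1.
  by exists k.
move=> s.
have [us|/asboolPn/existsNP[w /eqP ne]] := boolP (unbounded s); first by exists 0%N.
exists `|w|%N => _; apply: (@le_lt_trans _ _ (hit_lim s w)).
  by apply: hit_lim_mono; rewrite abszE; lia.
by rewrite lt_neqAle ne hit_lim_le1.
Qed.

Lemma unboundedE s w : unbounded s -> hit_lim s w = 1.
Proof. by move=> /asboolP. Qed.

Lemma live_unbounded s : unbounded s -> live s.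
Proof.
move=> /unboundedE-/(_ 0); apply: contra_eqT => /hit_lim_dead->.
by rewrite eq_sym oner_eq0.
Qed.

Lemma goal_bounded : ~~ unbounded goal.
Proof.
apply/asboolPn => /(_ (-1)); suff -> : hit_lim goal (-1) = 0.
  by move/esym/eqP; rewrite oner_eq0.
by apply/eqP; rewrite eq_le hit_lim_ge0 andbT; apply: hit_lim_le => n; rewrite hit_goal.
Qed.

(* An action that can leave the unbounded states loses a fixed amount of
   hitting probability, so unboundedness is witnessed by safe actions only. *)
Lemma unsafe_loss : exists (L : nat) (kap : R), [/\ 0 < kap, kap <= 1 &
  forall s w a t n, w < 0 -> enabled s a -> 0 < trans s a t -> ~~ unbounded t ->
    avg (hit n) s (w - L%:Z) a <= 1 - kap].
Proof.
have [k kP] := bounded_depth.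
have [eta [eta0 eta1 etaP]] := @finite_lower_bound R _ (fun s => ~~ unbounded s)
  (fun s => 1 - hit_lim s (- (k s)%:Z)) (fun s us => etrans (subr_gt0 _ _) (kP s us)).
have [q [q0 q1 qP]] := @finite_lower_bound R _
  (fun x : state M * act M * state M => 0 < trans x.1.1 x.1.2 x.2)
  (fun x => tprob R x.1.1 x.1.2 x.2) (fun x => etrans (tprob_gt0 R _ _ _)).
(* Starting this far down, the step gains at most [max_wgt M], so a bounded successor [t] still lies
   below its own depth [k t]; it is reached with probability at least [q] and then fails with
   probability at least [eta]. *)
exists (max_wgt M + \max_s k s)%N, (q * eta); split.
- exact: mulr_gt0.
- by rewrite mulr_ile1// ltW.
move=> s w a t n w0 ea pt ut.
apply: (@le_trans _ _ (avg (fun u _ => 1 + (- eta) * (u == t)%:R) s w a)); last first.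
  rewrite avgD avg_cst// avgZ lerD2l mulNr lerN2 mulrC ler_pM2l//.
  rewrite /avg (bigD1 t)//= eqxx mulr1 big1 ?addr0 => [|u /negbTE->]; last by rewrite mulr0.
  exact: (qP (s, a, t)).
apply: avg_le => u _; case: eqP => [->|_]; last by rewrite mulr0 addr0 hit_le1.
rewrite mulr1; apply: (@le_trans _ _ (hit_lim t (- (k t)%:Z))); last first.
  by have := etaP t ut; lra.
apply: le_trans (hit_le_lim n _ _) _; apply: hit_lim_mono.
have /andP[_ wu] := wgt_bound s a.
have kt : (k t <= \max_s k s)%N by exact: (@leq_bigmax _ k).
lia.
Qed.

(** If every enabled action of an unbounded state could leave the unbounded states, [unsafe_loss]
    would bound its hitting probability at [-1 - L] by [1 - kap]. *)
Lemma unbounded_stay : exists stay : state M -> act M, forall s, unbounded s ->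
  enabled s (stay s) /\ forall t, 0 < trans s (stay s) t -> unbounded t.
Proof.
have [L [kap [kap0 kap1 unsafe]]] := unsafe_loss.
suff /choice[f fP] : forall s, exists a, unbounded s -> enabled s a /\
    forall t, 0 < trans s a t -> unbounded t.
  by exists f.
move=> s.
apply: contrapT => /forallNP no.
have us : unbounded s by apply: contrapT => us; apply: (no (some_act s)).
suff : hit_lim s (-1 - L%:Z) <= 1 - kap.
  by rewrite (unboundedE _ us) => ?; lra.
apply: hit_lim_le => -[|n] /=.
  by rewrite andbC [0 <= _](_ : _ = false)/=; [rewrite subr_ge0|lia].
rewrite [0 <= _](_ : _ = false) ?andbF/=; last by lia.
set a := best _ _ _; have /not_implyP[_ /not_andP[|]] := no a.
  by rewrite /a bestP.
move=> /existsNP[t /not_implyP[pt /negP ut]].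
by apply: (unsafe s (-1) a t n) => //; rewrite /a bestP.
Qed.

(* A scheduler that never leaves the unbounded states risks nothing: either it
   climbs as high as wanted, or it never reaches goal. *)
Lemma unbounded_achievable s w k (v : R) : unbounded s -> 0 <= v ->
  (forall t w', live t -> k <= w' -> achievable goal t w' v) ->
  achievable goal s w (v / 2).
Proof.
move=> us v0 high.
have [L [kap [kap0 kap1 unsafe]]] := unsafe_loss.
have [stay stayP] := unbounded_stay.
have avoid t w' : unbounded t -> achievable goal t w' (0 : R).
  by move=> ut; exact: (@achievable_avoid R M goal goal_absorbing collapsed unbounded stay goal_bounded stayP t w' ut).
(* Imitate the optimal climb until it picks an unsafe action, then switch to staying; [x] is the
   probability of reaching weight [k] before that. Runs that give up had hitting probability at most
   [1 - kap]. *)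
have climb n t w' : unbounded t -> exists x, hit n t (w' - L%:Z) <= 1 - kap + kap * x /\
    achievable goal t (w' + k) (x * v).
  elim: n t w' => [|n IH] t w' ut.
    have [w0|w0] := leP 0 w'.
      exists 1; split; first by rewrite mulr1 subrK hit_le1.
      by rewrite mul1r; apply: high; [exact: live_unbounded|rewrite lerDr].
    exists 0; split; last by rewrite mul0r; exact: avoid.
    rewrite /= [0 <= _](_ : _ = false) ?andbF/=; last by lia.
    by rewrite mulr0 addr0 subr_ge0.
  have [w0|w0] := leP 0 w'.
    exists 1; split; first by rewrite mulr1 subrK hit_le1.
    by rewrite mul1r; apply: high; [exact: live_unbounded|rewrite lerDr].
  rewrite /= [0 <= _](_ : _ = false) ?andbF/=; last by lia.
  set a := best _ _ _; have ea : enabled t a by exact: bestP.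
  have [safe|] := pselect (forall u, 0 < trans t a u -> unbounded u); last first.
    move=> /existsNP[u /not_implyP[pu /negP uu]].
    exists 0; split; last by rewrite mul0r; exact: avoid.
    by rewrite mulr0 addr0; apply: (unsafe t w' a u n).
  have /choice[x xP] : forall u, exists x, 0 < trans t a u ->
      hit n u (w' + wgt t a - L%:Z) <= 1 - kap + kap * x /\
      achievable goal u (w' + wgt t a + k) (x * v).
    move=> u; have [/safe/(IH u (w' + wgt t a))[x xP]|_] := boolP (0 < trans t a u).
      by exists x.
    by exists 0.
  exists (\sum_u tprob R t a u * x u); split.
    apply: (@le_trans _ _ (avg (fun u _ => (1 - kap) + kap * x u) t w' a)).
      by apply: avg_le => u /xP[h _]; rewrite addrAC.
    by rewrite avgD avg_cst// avgZ.
  rewrite mulr_suml; under eq_bigr do rewrite -mulrA.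
  by apply: achievable_step => // u /xP[_]; rewrite addrAC.
(* This threshold forces [x >= 1 / 2]. *)
have : exists n, 1 - kap / 2 <= hit n s (w - k - L%:Z).
  apply: contrapT => /forallNP no.
  have : hit_lim s (w - k - L%:Z) <= 1 - kap / 2.
    by apply: hit_lim_le => n; rewrite leNgt; apply/negP => /ltW; exact: no.
  by rewrite (unboundedE _ us); lra.
move=> [n hn]; have [x [hx ax]] := climb n s (w - k) us; rewrite subrK in ax.
apply: achievable_le ax; rewrite mulrC ler_wpM2r//.
rewrite -(ler_pM2l kap0); lra.
Qed.

Lemma achievable_live : exists p C : R, [/\ 0 < p &
  forall s w, live s -> 0 <= w -> achievable goal s w (p * w%:~R - C)].
Proof.
have /choice[f fP] : forall s, exists x : R * R, 0 < x.1 /\ (live s ->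
    forall w, 0 <= w -> achievable goal s w (x.1 * w%:~R - x.2)).
  move=> s; have [/asboolP[h [hp hl]]|_] := boolP (live s); last by exists (1, 0).
  have [p [C [p0 C0 H]]] := achievable_path R goal_absorbing collapsed hp.
  exists (p, C - p * (path_wgt s h)%:~R); split => // _ w w0.
  have := H w (w + path_wgt s h)%:~R; rewrite hl => /(_ (achievable_goal R goal_absorbing _)).
  apply: achievable_le; rewrite max_r; last by rewrite oppr_le0 ler0z.
  rewrite intrD /=; lra.
have [p [p0 _ pP]] := @finite_lower_bound R _ predT (fun s => (f s).1)
  (fun s _ => (fP s).1).
exists p, (\sum_s `|(f s).2|); split => // s w ls w0.
apply: achievable_le ((fP s).2 ls w w0); apply: lerB.
  by rewrite ler_wpM2r ?ler0z// pP.
rewrite (bigD1 s)//= (le_trans (ler_norm _))// lerDl.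
by apply: sumr_ge0.
Qed.

Lemma unbounded_infinite s0 s : unbounded s -> reachable s0 s ->
  forall v : R, achievable goal s0 0 v.
Proof.
move=> us [h [hp hl]] v.
have [p [C [p0 C0 H]]] := achievable_path R goal_absorbing collapsed hp.
have [p' [C' [p'0 live_ach]]] := achievable_live.
(* Chosen so that [p * (v' / 2) - C >= v]; the level [k] then makes [p' * k - C' >= v']. *)
pose v' := Num.max 0 (2 * ((v + C) / p)).
pose k := (Num.truncn ((v' + C') / p')).+1.
have hi : achievable goal (last_state s0 h) (0 + path_wgt s0 h) (v' / 2).
  rewrite hl.
  apply: (@unbounded_achievable _ _ k%:Z) => //; first by rewrite /v' le_max lexx.
  move=> t w lt kw; apply: achievable_le (live_ach t w lt (le_trans _ kw)) => //.
  rewrite lerBrDr mulrC -ler_pdivrMr//; apply: (@le_trans _ _ k%:R).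
    exact/ltW/truncnS_gt.
  by rewrite -[k%:R]/(k%:Z%:~R) ler_int.
apply: achievable_le (H _ _ hi).
rewrite oppr0 maxxx subr0 lerBrDr mulrC -ler_pdivrMr//.
have : 2 * ((v + C) / p) <= v' by rewrite /v' le_max lexx orbT.
lra.
Qed.

End hitting.

(** * Geometric decay of climbing probabilities and the resulting potential *)

Section climbing.
Variables (R : realType) (M : mdp) (goal : state M).
Hypothesis goal_absorbing : absorbing goal.
Hypothesis collapsed : fail_collapsed goal.
Hypothesis bounded : forall s, ~~ unbounded R goal s.
Implicit Types (s t : state M) (w : int).

Let ph s w : R := hit_lim R goal s w.

(** Raise the target instead of lowering the start: a run from [w <= 0] to level [K + W + 1] first
    passes level 0, overshooting by at most [W], and then has more than [K] levels left, which it
    climbs with probability at most [1 - eta]. *)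
Lemma hit_lim_contract : exists (L : nat) (rho : R), [/\ 0 <= rho, rho < 1 &
  forall s w, w <= 0 -> ph s (w - L.+1%:Z) <= rho * ph s w].
Proof.
have [k kP] := bounded_depth R goal.
have [eta [eta0 eta1 etaP]] := @finite_lower_bound R _ predT
  (fun s => 1 - ph s (- (k s)%:Z)) (fun s _ => etrans (subr_gt0 _ _) (kP s (bounded s))).
pose K := \max_s k s; pose W := max_wgt M.
exists (K + W)%N, (1 - eta); split; rewrite ?subr_ge0 ?gtrBl//.
have phK s w : w <= - K%:Z -> ph s w <= 1 - eta.
  move=> wK; apply: (@le_trans _ _ (ph s (- (k s)%:Z))).
    apply: hit_lim_mono; apply: le_trans wK _.
    by rewrite lerN2 lez_nat; exact: (@leq_bigmax _ k).
  by have := etaP s isT; lra.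
(* w <= W rather than w <= 0, as a step may overshoot level 0 by up to W. *)
have main n s w : w <= W%:Z -> hit R goal n s (w - (K + W).+1%:Z) <= (1 - eta) * ph s w.
  elim: n s w => [|n IH] s w wW.
    rewrite /= [0 <= _](_ : _ = false) ?andbF; last by lia.
    by rewrite mulr_ge0 ?subr_ge0//; exact: hit_lim_ge0.
  have [ls|ls] := boolP (live goal s); last first.
    by rewrite hit_dead// mulr_ge0 ?subr_ge0//; exact: hit_lim_ge0.
  have [w0|w0] := leP 0 w.
    rewrite [ph s w]hit_lim_stop// mulr1.
    apply: le_trans (phK s (w - (K + W).+1%:Z) _); last by lia.
    exact: hit_le_lim.
  rewrite [leLHS]/= [0 <= _](_ : _ = false) ?andbF/=; last by lia.
  set a := best _ _ _; have ea : enabled s a by exact: bestP.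
  apply: (@le_trans _ _ ((1 - eta) * avg ph s w a)); last first.
    by rewrite ler_wpM2l ?subr_ge0//; exact: hit_lim_super.
  rewrite -avgZ; apply: avg_le => t _; rewrite addrAC; apply: IH.
  by have /andP[_ wu] := wgt_bound s a; lia.
by move=> s w w0; apply: hit_lim_le => n; apply: main; lia.
Qed.

Let partial (n : nat) s w : R := \sum_(k < n) ph s (w - k.+1%:Z).

Let partial_nd s w : nondecreasing_seq (fun n => partial n s w).
Proof.
by apply/nondecreasing_seqP => n; rewrite /partial big_ord_recr lerDl; exact: hit_lim_ge0.
Qed.

Let partialD m n s w : partial (m + n) s w = partial m s w + partial n s (w - m%:Z).
Proof.
rewrite /partial big_split_ord; congr (_ + _); apply: eq_bigr => i _ /=.
by congr (ph _ _); lia.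
Qed.

Let partial_le n s w : partial n s w <= n%:R.
Proof.
rewrite -[leRHS](_ : \sum_(k < n) 1 = _); last by rewrite sumr_const card_ord.
by apply: ler_sum => k _; exact: hit_lim_le1.
Qed.

Let partial_mono n s w w' : w <= w' -> partial n s w <= partial n s w'.
Proof.
by move=> ww'; apply: ler_sum => k _; apply: hit_lim_mono => //; lia.
Qed.

(** [H] sums the probabilities of climbing to the levels 1, 2, and so on. In a live state of weight
    [w > 0] the first [w] summands are 1. At weight 0, contraction bounds a partial sum [x] by
    [L' + rho * x], whence the value of [C]. *)
Lemma climb_potential : exists (H : state M -> int -> R) (C : R),
  [/\ (forall s w a, enabled s a -> avg H s w a <= H s w),
      (forall s w, 0 <= H s w) /\ (forall s w w', w <= w' -> H s w <= H s w'),
      (forall s w, live goal s -> w%:~R <= H s w) /\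
        (forall s w, ~~ live goal s -> H s w = 0),
      (forall s w, H s w <= Num.max w%:~R 0 + C) &
      (forall eps, 0 < eps -> exists K0 : nat, forall K s, (K0 <= K)%N ->
         H s (- K%:Z) <= eps)].
Proof.
have [L [rho [rho0 rho1 contract]]] := hit_lim_contract.
pose L' := L.+1; pose C := L'%:R / (1 - rho).
have rho1' : 0 < 1 - rho by rewrite subr_gt0.
have C0 : 0 <= C by rewrite divr_ge0// ltW.
have partial_contract n s w : w <= 0 -> partial n s (w - L'%:Z) <= rho * partial n s w.
  move=> w0; rewrite /partial mulr_sumr; apply: ler_sum => k _.
  rewrite addrAC; apply: contract; lia.
have bound0 n s : partial n s 0 <= C.
  rewrite /C ler_pdivlMr//.
  have : partial n s 0 <= partial (L' + n) s 0 by apply: partial_nd; lia.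
  rewrite partialD; have := partial_le L' s 0.
  have := partial_contract n s 0 (lexx _); lra.
have bound n s w : partial n s w <= Num.max w%:~R 0 + C.
  have [w0|w0] := leP w 0.
    rewrite max_r ?add0r; last by rewrite lerz0.
    exact: le_trans (partial_mono n s w0) (bound0 n s).
  have [m wm] : exists m : nat, w = m%:Z by exists `|w|%N; rewrite gtz0_abs.
  rewrite wm max_l ?ler0z//.
  apply: (@le_trans _ _ (partial (m + n) s m%:Z)); first by apply: partial_nd; lia.
  by rewrite partialD subrr; apply: lerD; [exact: partial_le|exact: bound0].
pose H s w : R := limn (fun n => partial n s w).
have cvH s w : partial n s w @[n --> \oo] --> H s w.
  apply: nondecreasing_is_cvgn => //.
  by exists (Num.max w%:~R 0 + C) => _ [n _ <-]; exact: bound.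
have leH n s w : partial n s w <= H s w.
  apply: (@nondecreasing_cvgn_le _ (fun n => partial n s w)) => //.
have Hle s w c : (forall n, partial n s w <= c) -> H s w <= c.
  move=> hc; apply: limr_le; first exact: cvH.
  by near=> n; exact: hc.
have Hcontract s w : w <= 0 -> H s (w - L'%:Z) <= rho * H s w.
  move=> w0; apply: Hle => n; apply: le_trans (partial_contract n s w w0) _.
  exact: ler_wpM2l.
have Hmono s w w' : w <= w' -> H s w <= H s w'.
  by move=> ww'; apply: Hle => n; apply: le_trans (leH n s w'); exact: partial_mono.
exists H, C; split.
- move=> s w a ea; apply: (avg_limit_le (g := partial)) => // n.
  exists n; rewrite /avg /partial; under eq_bigr do rewrite mulr_sumr.
  rewrite exchange_big; apply: ler_sum => k _ /=.
  apply: le_trans (hit_lim_super R goal _ ea).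
  by apply: ler_sum => t _; rewrite addrAC.
- split => // s w; apply: le_trans (leH 0%N s w); by rewrite /partial big_ord0.
- split => [s w ls|s w ls].
    have [w0|w0] := leP w 0.
      apply: (@le_trans _ _ 0); first by rewrite lerz0.
      by apply: le_trans (leH 0%N s w); rewrite /partial big_ord0.
    have [m wm] : exists m : nat, w = m%:Z by exists `|w|%N; rewrite gtz0_abs.
    apply: le_trans (leH m s w); rewrite wm /partial.
    rewrite (eq_bigr (fun=> 1)) => [|k _]; first by rewrite sumr_const card_ord.
    by apply: hit_lim_stop => //; have := ltn_ord k; lia.
  apply/eqP; rewrite eq_le; apply/andP; split.
    by apply: Hle => n; rewrite /partial big1// => k _; exact: hit_lim_dead.
  by apply: le_trans (leH 0%N s w); rewrite /partial big_ord0.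
- by move=> s w; apply: Hle.
move=> eps eps0.
have [j hj] : exists j, rho ^+ j * C <= eps.
  have cv : rho ^+ j * C @[j --> \oo] --> (0 : R).
    rewrite -[X in _ --> X](mul0r C); apply: cvgM; last exact: cvg_cst.
    by apply: cvg_expr; rewrite ger0_norm.
  have /cvgrPdist_le /(_ eps eps0) [j _ /(_ j (leqnn j))] := cv.
  rewrite /= sub0r normrN => hj; exists j; exact: le_trans (ler_norm _) hj.
exists (j * L')%N => K s jK.
apply: (@le_trans _ _ (H s (- (j * L')%:Z))); first by apply: Hmono; lia.
(* Every descent by [L'] below weight 0 costs a factor [rho]. *)
apply: le_trans hj; elim: (j) => [|i IH].
  by rewrite mul0n oppr0 expr0 mul1r; apply: Hle => n; exact: bound0.
have -> : - (i.+1 * L')%:Z = - (i * L')%:Z - L'%:Z by rewrite mulSn; lia.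
apply: (le_trans (Hcontract _ _ _)); first by lia.
by rewrite exprS -mulrA ler_wpM2l.
Unshelve. all: by end_near. Qed.

End climbing.

(** * Discounting *)

Section discounted.
Variables (R : realType) (M : mdp) (goal : state M).
Hypothesis goal_absorbing : absorbing goal.
Hypothesis collapsed : fail_collapsed goal.
Variable H : state M -> int -> R.
Hypothesis H_super : forall s w a, enabled s a -> avg H s w a <= H s w.
Hypothesis H_ge0 : forall s w, 0 <= H s w.
Hypothesis H_gain : forall s w, gain R goal s w <= H s w.
Variable beta : R.
Hypotheses (beta0 : 0 <= beta) (beta1 : beta < 1).
Implicit Types (s t : state M) (w : int) (g : state M -> int -> R).

Let gain := gain R goal.
Let loss := loss R goal.

(** The coefficients are spelled out to match [expect_lin]. *)
Definition payoff s w : R := 1 * gain s w + (-1) * loss s w.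

(* As goal is absorbing, collecting the payoff at a geometric random time is the
   same as discounting the number of steps to goal. *)
Definition bellman g s w : R :=
  (1 - beta) * payoff s w + beta * avg g s w (best g s w).

(** Value iteration starts from the superharmonic majorant [H] and therefore decreases. *)
Let vi n := iter n bellman H.

Let beta1' : 0 <= 1 - beta. Proof. by rewrite subr_ge0 ltW. Qed.

Let bellman_le g g' : (forall s w, g s w <= g' s w) ->
  forall s w, bellman g s w <= bellman g' s w.
Proof.
move=> gg' s w; rewrite lerD2l ler_wpM2l//.
apply: le_trans (best_ge _ _ (bestP g s w)).
by apply: avg_le => t _.
Qed.

Let payoff_le s w : payoff s w <= H s w.
Proof.
rewrite /payoff mul1r; have := H_gain s w; have := loss_ge0 R goal s w.
rewrite -/loss -/gain; lra.
Qed.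

Let vi_ni s w : nonincreasing_seq (fun n => vi n s w).
Proof.
apply/nonincreasing_seqP => n; elim: n s w => [|n IH] s w.
  rewrite /vi /= /bellman.
  have := ler_wpM2l beta0 (H_super w (bestP H s w)).
  have := ler_wpM2l beta1' (payoff_le s w); lra.
exact: bellman_le.
Qed.

(** Here [j] is the current time and [i] a number of steps after which the horizon [N] is surely
    past. One Bellman step collects [1 - beta] times the payoff at time [j] and moves on to
    [j.+1]. *)
Lemma iterated_bellman_ge (sch : scheduler R M) s w N C :
  (forall n, expect sch s w n loss <= C) ->
  forall n i j, (N <= i + j)%N ->
    beta ^+ i * expect sch s w N gain - C <= expect sch s w j (vi n).
Proof.
move=> lossC n.
have C0 : 0 <= C by apply: le_trans (lossC 0%N); exact/expect_ge0/loss_ge0.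
have e0 m : 0 <= expect sch s w m gain by exact/expect_ge0/gain_ge0.
elim: n => [|n IH] i j Nij.
  have : expect sch s w N gain <= expect sch s w j H.
    have [Nj|/ltnW jN] := leqP N j.
      apply: (le_trans (expect_gain_nd goal_absorbing sch s w Nj)).
      exact: expect_le.
    apply: (@le_trans _ _ (expect sch s w N H)); first exact: expect_le.
    rewrite -(subnKC jN); elim: (N - j)%N => [|m IHm]; first by rewrite addn0.
    by rewrite addnS; apply: le_trans IHm; exact: expect_super.
  have : beta ^+ i * expect sch s w N gain <= expect sch s w N gain.
    by rewrite ler_piMl// exprn_ile1// ltW.
  by rewrite [vi 0]/=; lra.
have step : (1 - beta) * (expect sch s w j gain - expect sch s w j loss) +
    beta * expect sch s w j.+1 (vi n) <= expect sch s w j (vi n.+1).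
  rewrite [vi n.+1]/= /bellman expect_lin /payoff expect_lin mul1r mulN1r lerD2l.
  rewrite ler_wpM2l//; apply: expect_super => t v a; exact: best_ge.
apply: le_trans step; have lj := lossC j.
(* With [i = 0] the gain at time [j] is already at least that at [N], so no discount is spent;
   otherwise the current gain is only known to be nonnegative and one factor [beta] is spent. *)
case: i Nij => [|i] Nij.
  have := ler_wpM2l beta0 (IH 0%N j.+1 (leqW Nij)).
  have := ler_wpM2l beta1' (expect_gain_nd goal_absorbing sch s w Nij).
  have := ler_wpM2l beta1' lj; rewrite expr0 -/gain; lra.
have := ler_wpM2l beta0 (IH i j.+1 (_ : (N <= i + j.+1)%N)).
rewrite addnS -addSn => /(_ Nij).
have := ler_wpM2l beta1' lj; have := mulr_ge0 beta1' (e0 j); rewrite exprS -mulrA; lra.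
Qed.

Let v s w : R := limn (fun n => vi n s w).

Let vi_bounded s w : exists c, forall n, c <= vi n s w.
Proof.
have [C [_ /(_ s w)[sch [N [C' [hC _]]]]]] := achievable_low R goal_absorbing collapsed.
exists (beta ^+ N * expect sch s w N gain - C') => n.
by rewrite -(expect0 sch s w (vi n)); apply: iterated_bellman_ge => //; rewrite addn0.
Qed.

Let cvg_vi s w : vi n s w @[n --> \oo] --> v s w.
Proof.
apply: nonincreasing_is_cvgn; first exact: vi_ni.
by have [c cP] := vi_bounded s w; exists c => _ [n _ <-]; exact: cP.
Qed.

Let v_le n s w : v s w <= vi n s w.
Proof. by apply: (@nonincreasing_cvgn_ge _ (fun n => vi n s w)); [exact: vi_ni|exact: cvg_vi]. Qed.

(** The best action may change with [n], but there are finitely many actions, so their averages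
    converge uniformly. *)
Let v_bellman s w : v s w <= bellman v s w.
Proof.
apply/ler_addgt0Pr => e e0.
have : \forall n \near \oo, forall a, avg (vi n) s w a <= avg v s w a + e.
  apply: filter_forall => a.
  have cv : avg (vi n) s w a @[n --> \oo] --> avg v s w a.
    by apply: cvg_avg => t; exact: cvg_vi.
  by apply: (cvgr_le _ cv); rewrite ltrDl.
move=> [n _ /(_ n (leqnn n)) /= hn].
apply: (le_trans (v_le n.+1 s w)); rewrite [vi n.+1]/= /bellman -addrA lerD2l.
have := ler_wpM2l beta0 (hn (best (vi n) s w)).
have := ler_wpM2l beta0 (best_ge v w (bestP (vi n) s w)).
have := mulr_ge0 beta1' (ltW e0); lra.
Qed.

Lemma discounted_value : exists (u : state M -> int -> R)
    (pi : state M -> int -> act M), [/\ forall s w, enabled s (pi s w),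
  forall s w, u s w <= H s w,
  forall s w, u s w <= (1 - beta) * payoff s w + beta * avg u s w (pi s w) &
  forall (sch : scheduler R M) s w N C, (forall n, expect sch s w n loss <= C) ->
    beta ^+ N * expect sch s w N gain - C <= u s w].
Proof.
exists v, (best v); split => //.
- by move=> s w; exact: bestP.
- by move=> s w; exact: (v_le 0%N).
move=> sch s w N C lossC; apply: limr_ge; first exact: cvg_vi.
near=> n; rewrite -(expect0 sch s w (vi n)).
by apply: iterated_bellman_ge => //; rewrite addn0.
Unshelve. all: by end_near. Qed.

End discounted.

(** * Tools for the limit of policies and discount factors *)

Lemma finite_agreement_limit (X : eqType) (A : finType) (f : nat -> X -> A) :
  exists g : X -> A, forall (r : seq X) J,
    exists j, (J <= j)%N /\ forall x, x \in r -> f j x = g x.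
Proof.
(* As [A] is finite, each point has a value taken on a [U]-large set of indices. Finitely many such
   sets meet, beyond any [J]. *)
have [U [UU sU]] := @ultraFilterLemma _ (nbhs \oo) _.
have PU : ProperFilter U by apply: ultra_proper.
have /choice[g gP] : forall x, exists a, U [set j | f j x = a].
  move=> x; apply: contrapT => /forallNP no.
  suff : U set0 by exact: filter_not_empty.
  have : U [set j | forall a, f j x <> a].
    apply: filter_forall => a; by have [/no|] := in_ultra_setVsetC [set j | f j x = a] UU.
  by apply: filterS => j /(_ (f j x)); exact.
exists g => r J.
have : U [set j | (J <= j)%N /\ forall x, x \in r -> f j x = g x].
  elim: r => [|x r IH].
    by apply: filterS (sU _ (nbhs_infty_ge J)) => j Jj; split.
  apply: filterS2 (gP x) IH => j /= fx [Jj IH]; split=> // y.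
  by rewrite in_cons => /predU1P[->//|/IH].
by move=> /filter_ex[j]; exists j.
Qed.

Lemma bernoulli_ineq (R : realType) (x : R) n : 0 <= x -> x <= 1 ->
  1 - n%:R * (1 - x) <= x ^+ n.
Proof.
move=> x0 x1; elim: n => [|n IH]; first by rewrite mul0r subr0.
rewrite exprS; apply: le_trans (ler_wpM2l x0 IH).
have : 0 <= n%:R * ((1 - x) * (1 - x)) by rewrite !mulr_ge0 ?subr_ge0.
rewrite -natr1; lra.
Qed.

Lemma geometric_slack (R : realType) (x y z c : R) : 0 <= x -> x < 1 ->
  (forall n, y <= z + x ^+ n * c) -> y <= z.
Proof.
move=> x0 x1 h.
have cv : z + x ^+ n * c @[n --> \oo] --> z + 0 * c.
  apply: cvgD; first exact: cvg_cst.
  apply: cvgM; last exact: cvg_cst.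
  by apply: cvg_expr; rewrite ger0_norm.
rewrite mul0r addr0 in cv; rewrite -(cvg_lim (@Rhausdorff R) cv).
apply: limr_ge; first by apply: cvgP; exact: cv.
by near=> n; exact: h.
Unshelve. all: by end_near. Qed.

(** * The limit policy *)

Section optimal.
Variables (R : realType) (M : mdp) (goal : state M).
Hypothesis goal_absorbing : absorbing goal.
Hypothesis collapsed : fail_collapsed goal.
Hypothesis bounded : forall s, ~~ unbounded R goal s.
Implicit Types (s t : state M) (w : int) (g : state M -> int -> R).

Let gain := gain R goal.
Let loss := loss R goal.

Let step (pi : state M -> int -> act M) g s w : R := avg g s w (pi s w).

Lemma expect_stationary_iter (pi : state M -> int -> act M)
    (epi : forall s w, enabled s (pi s w)) s n g :
  expect (stationary R epi) s 0 n g = iter n (step pi) g s 0.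
Proof.
elim: n g => [|n IH] g; first by rewrite expect0.
by rewrite expect_stationary IH -iterSr.
Qed.

Lemma goal_live : live goal goal.
Proof. by apply/asboolP; exists [::]. Qed.

Let rate (j : nat) : R := 1 - j.+2%:R^-1.

Let rate0 j : 0 <= rate j.
Proof. by rewrite subr_ge0 invf_le1// ler1n. Qed.

Let rate1 j : rate j < 1.
Proof. by rewrite gtrBl invr_gt0. Qed.

(** With the horizons [N] and [N'] free, all quantities are real numbers; the passage to possibly
    infinite expectations is left to the end. *)
Lemma optimal_policy s0 : exists (pi : state M -> int -> act M)
    (epi : forall s w, enabled s (pi s w)),
  let opt := stationary R epi in
  (exists c, forall n, expect opt s0 0 n gain <= c) /\
  forall (sch : scheduler R M) N N' C,
    (forall n, expect sch s0 0 n loss <= C) ->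
    expect sch s0 0 N gain - C <=
      limn (fun n => expect opt s0 0 n gain) - expect opt s0 0 N' loss.
Proof.
have [H [CH [H_super [H_ge0 H_mono] [H_live H_dead] H_le H_tail]]] :=
  climb_potential collapsed bounded.
have H_gain s w : gain s w <= H s w.
  rewrite /gain gainE; case: eqP => [->|_]; last exact: H_ge0.
  by rewrite ge_max H_ge0 H_live// goal_live.
have /choice[u /choice[f fP]] : forall j, exists u pi, [/\
    forall s w, enabled s (pi s w), forall s w, u s w <= H s w,
    forall s w, u s w <= (1 - rate j) * payoff R goal s w + rate j * avg u s w (pi s w) &
    forall (sch : scheduler R M) s w N C, (forall n, expect sch s w n loss <= C) ->
      rate j ^+ N * expect sch s w N gain - C <= u s w].
  by move=> j; exact: discounted_value.
have [pi' pi'P] := finite_agreement_limit (fun j (x : state M * int) => f j x.1 x.2).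
pose pi s w := pi' (s, w).
have epi s w : enabled s (pi s w).
  have [j [_ /(_ (s, w))]] := pi'P [:: (s, w)] 0%N.
  by rewrite mem_head /pi => <- //; have [] := fP j.
have agree K J : exists j, (J <= j)%N /\
    forall s w, `|w| <= (2 * K)%:Z -> f j s w = pi s w.
  have [j [Jj jP]] := pi'P [seq (s, i%:Z - (2 * K)%:Z) |
    s <- enum (state M), i <- iota 0 (4 * K).+1] J.
  exists j; split=> // s w wK; apply: (jP (s, w)); apply/allpairsP.
  exists (s, `|(w + (2 * K)%:Z)%R|%N); split.
  - by rewrite mem_enum.
  - by rewrite mem_iota [(_, _).2]/=; lia.
  - by rewrite [(_, _).1]/= [(_, _).2]/=; congr (_, _); lia.
exists pi, epi => opt.
pose G n := iter n (step pi) gain; pose L n := iter n (step pi) loss.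
have step_le g g' : (forall s w, g s w <= g' s w) ->
    forall s w, step pi g s w <= step pi g' s w.
  by move=> gg' s w; apply: avg_le => t _.
have G_nd s w : nondecreasing_seq (fun n => G n s w).
  apply/nondecreasing_seqP => n; elim: n s w => [|n IH] s w; last exact: step_le.
  exact: gain_sub.
have G_le n s w : G n s w <= H s w.
  elim: n s w => [|n IH] s w //=; apply: le_trans (H_super _ _ _ (epi s w)).
  exact: step_le.
pose F s w : R := limn (fun n => G n s w).
have cvG s w : G n s w @[n --> \oo] --> F s w.
  apply: nondecreasing_is_cvgn; first exact: G_nd.
  by exists (H s w) => _ [n _ <-]; exact: G_le.
have G_leF n s w : G n s w <= F s w.
  by apply: (@nondecreasing_cvgn_le _ (fun n => G n s w)); [exact: G_nd|exact: cvG].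
have F_super s w : avg F s w (pi s w) <= F s w.
  by apply: (avg_limit_le (g := G)) => // n; exists n.+1.
have gainF s w : gain s w <= F s w := G_leF 0%N s w.
have F0 s w : 0 <= F s w by apply: le_trans (gainF s w); exact: gain_ge0.
split.
  by exists (H s0 0) => n; rewrite expect_stationary_iter; exact: G_le.
move=> sch N N' C lossC.
have -> : (fun n => expect opt s0 0 n gain) = (fun n => G n s0 0).
  by apply/funext => n; exact: expect_stationary_iter.
rewrite -/(F s0 0).
rewrite expect_stationary_iter -/(L N').
apply/ler_addgt0Pr => e e0.
have [K0 K0P] := H_tail (e / 8) (divr_gt0 e0 (ltr0n _ 8)).
pose W := max_wgt M.
(* [K0] makes [H] small at weight [-K], [N' * W] keeps the first [N'] steps inside the window, and
   the last term gives [CH <= K]. *)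
pose K := maxn K0 (maxn (N' * W) (Num.bound `|CH|)).
have K0K : (K0 <= K)%N by rewrite leq_maxl.
have NK : (N' * W <= K)%N by rewrite /K; lia.
have CK : CH <= K%:R.
  apply: (le_trans (ler_norm _)); apply: (@le_trans _ _ (Num.bound `|CH|)%:R).
    exact/ltW/archi_boundP.
  by rewrite ler_nat /K; lia.
pose eN := expect sch s0 0 N gain; pose lN := L N' s0 0.
have eN0 : 0 <= eN by apply: expect_ge0; exact: gain_ge0.
have lN0 : 0 <= lN.
  rewrite /lN /L -(expect_stationary_iter epi); apply: expect_ge0; exact: loss_ge0.
(* By Bernoulli, replacing [beta ^+ N] and [beta ^+ N'] by 1 costs at most [b * (1 - beta)]. *)
pose b := N%:R * eN + N'%:R * lN.
have b0 : 0 <= b by rewrite addr_ge0// mulr_ge0.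
have [j [Jj jpi]] := agree K (Num.bound (2 * b / e)).
have [_ u_le u_eq u_ge] := fP j.
pose beta := rate j.
have be : b * (1 - beta) <= e / 2.
  rewrite /beta /rate opprB addrCA subrr addr0 ler_pdivrMr//.
  have : 2 * b / e < j.+2%:R.
    apply: (@lt_le_trans _ _ (Num.bound (2 * b / e))%:R).
      by apply: archi_boundP; apply: divr_ge0; [exact: mulr_ge0|exact: ltW].
    by rewrite ler_nat; lia.
  by rewrite ltr_pdivrMr//; lra.
(* Superharmonic majorant of the discounted value outside the window |w| <= 2K,
   yet small at the start. *)
pose Q s w := e / 8 + 3 * H s (w - K%:Z).
have Q_ge0 s w : 0 <= Q s w by rewrite addr_ge0 ?mulr_ge0// ?invr_ge0// ltW.
have Q_super s w a : enabled s a -> avg Q s w a <= Q s w.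
  move=> ea; have -> : avg Q s w a = e / 8 + 3 * avg H s (w - K%:Z) a.
    rewrite /Q avgD avg_cst// avgZ; congr (_ + _ * _).
    by apply: eq_bigr => t _; rewrite addrAC.
  by rewrite lerD2l ler_wpM2l// H_super.
have Q_out s w : (2 * K)%:Z < `|w| -> H s w <= Q s w.
  move=> Kw; have [w0|w0] := leP 0 w; last first.
    rewrite /Q -[leLHS]addr0; apply: lerD; last by rewrite mulr_ge0.
    by apply: le_trans (K0P K s K0K); apply: H_mono; lia.
  (* The factor 3 in [Q] is used here: for [w >= 2 * K], [H s w <= w + K <= 3 * (w - K)]. *)
  have [ls|/H_dead->//] := boolP (live goal s).
  have := H_live s (w - K%:Z) ls; have := H_le s w.
  rewrite max_l ?ler0z// intrB /Q.
  have : (2 * K%:R : R) <= w%:~R.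
    by rewrite -natrM -[_%:R]/((2 * K)%:Z%:~R) ler_int; lia.
  have : (0 : R) <= K%:R by []. lra.
have r1 : 0 <= 1 - beta by rewrite subr_ge0 ltW// rate1.
have uQF s w : u j s w <= Q s w + F s w.
  (* The slack starts as a bound for [u j] inside the window and shrinks by [beta] with each use of
     [u_eq], where [pi] agrees with [f j]. Outside the window [Q] alone dominates. *)
  apply: (@geometric_slack _ beta _ _ ((2 * K)%:R + `|CH|) (rate0 j) (rate1 j)) => n.
  elim: n s w => [|n IH] s w; have [wK|wK] := leP `|w| (2 * K)%:Z.
  - rewrite expr0 mul1r; apply: (le_trans (u_le s w)); apply: (le_trans (H_le s w)).
    rewrite -[leLHS]add0r; apply: lerD; first by rewrite addr_ge0.
    apply: lerD; last exact: ler_norm.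
    by rewrite ge_max ler0n andbT -[_%:R]/((2 * K)%:Z%:~R) ler_int; lia.
  - rewrite -addrA; apply: (le_trans (u_le s w)); apply: (le_trans (Q_out s w wK)).
    by rewrite lerDl addr_ge0// mulr_ge0// exprn_ge0// rate0.
  - apply: (le_trans (u_eq s w)); rewrite jpi//.
    set c := (_ + _) in IH *.
    have : avg (u j) s w (pi s w) <=
        avg (fun s w => Q s w + (F s w + beta ^+ n * c)) s w (pi s w).
      by apply: avg_le => t _; rewrite addrA.
    rewrite (avgD Q) (avgD F) avg_cst// => /(ler_wpM2l (rate0 j)).
    have := ler_wpM2l (rate0 j) (Q_super s w _ (epi s w)).
    have := ler_wpM2l (rate0 j) (F_super s w).
    have := ler_wpM2l r1 (gainF s w); have := mulr_ge0 r1 (Q_ge0 s w).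
    have := mulr_ge0 r1 (loss_ge0 R goal s w).
    rewrite /payoff mul1r mulN1r -/gain -/loss exprS -/beta.
    lra.
  - rewrite -addrA; apply: (le_trans (u_le s w)); apply: (le_trans (Q_out s w wK)).
    by rewrite lerDl addr_ge0// mulr_ge0// exprn_ge0// rate0.
(* The bound [uQF] leaves out the losses of [pi]. Those at time [n] are put back for starts from
   which [n] steps cannot leave the window. *)
have uQFL n s w : `|w| + (n * W)%:Z <= (2 * K)%:Z ->
    u j s w <= Q s w + (F s w + (- beta ^+ n) * L n s w).
  elim: n s w => [|n IH] s w wK.
    have [sg|sg] := eqVneq s goal; last first.
      rewrite expr0 mulN1r /L /= /loss lossE (negbTE sg) subr0; exact: uQF.
    (* At [goal] the inequality for [u j] can be solved: [u j] is at most the payoff. *)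
    subst s; have := u_eq goal w; rewrite avg_absorbing//; last by have [-> _ _ _] := fP j.
    have := gainF goal w; have := Q_ge0 goal w.
    rewrite expr0 mulN1r /payoff mul1r mulN1r /L /= -/gain -/loss -/beta => h1 h2 h3.
    have : (1 - beta) * u j goal w <= (1 - beta) * (gain goal w - loss goal w) by lra.
    rewrite ler_pM2l ?subr_gt0 ?rate1//; lra.
  apply: (le_trans (u_eq s w)); rewrite jpi; last by lia.
  have : avg (u j) s w (pi s w) <=
       avg (fun s w => Q s w + (F s w + (- beta ^+ n) * L n s w)) s w (pi s w).
    apply: avg_le => t _; apply: IH.
    have /andP[wl wu] := wgt_bound s (pi s w); rewrite -/W in wl wu; lia.
  rewrite (avgD Q) (avgD F) avgZ -[avg (L n) s w _]/(L n.+1 s w) => /(ler_wpM2l (rate0 j)).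
  have := ler_wpM2l (rate0 j) (Q_super s w _ (epi s w)).
  have := ler_wpM2l (rate0 j) (F_super s w).
  have := ler_wpM2l r1 (gainF s w); have := mulr_ge0 r1 (Q_ge0 s w).
  have := mulr_ge0 r1 (loss_ge0 R goal s w).
  rewrite /payoff mul1r mulN1r -/gain -/loss exprS -/beta.
  lra.
have := uQFL N' s0 0; rewrite normr0 add0r => /(_ _).
move=> /(_ (ltac:(lia))) up.
have lo := u_ge sch s0 0 N C lossC.
have Q0 : Q s0 0 <= e / 2.
  by rewrite /Q sub0r; have := K0P K s0 K0K; lra.
have bN := ler_wpM2r eN0 (bernoulli_ineq N (rate0 j) (ltW (rate1 j))).
have bN' := ler_wpM2r lN0 (bernoulli_ineq N' (rate0 j) (ltW (rate1 j))).
rewrite -/eN -/lN -/beta in up lo bN bN' *.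
move: be; rewrite /b; lra.
Qed.

End optimal.

(** * Partial expectations as limits over finite horizons *)

Section finite_horizon.
Variables (R : realType) (M : mdp) (sch : scheduler R M).
Implicit Types (s t : state M) (h : seq (step M)) (F : seq (step M) -> R).

Fixpoint histories n : seq (seq (step M)) :=
  if n is m.+1 then
    [seq rcons h x | h <- histories m, x <- index_enum (step M)]
  else [:: [::]].

Lemma size_histories n h : h \in histories n -> size h = n.
Proof.
elim: n h => [|n IH] h /=; first by rewrite inE => /eqP->.
by move=> /allpairsP[[g x] /= [/IH <- _ ->]]; rewrite size_rcons.
Qed.

Lemma sum_histories s n F :
  \sum_(h <- histories n) prefix_prob sch s h * F h = iter n (next sch s) F [::].
Proof.
elim: n F => [|n IH] F; first by rewrite /= big_seq1 mul1r.
rewrite iterSr -IH /= big_allpairs_dep /=; apply: eq_bigr => h _.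
rewrite /next mulr_sumr.
transitivity (\sum_a \sum_t prefix_prob sch s (rcons h (a, t)) * F (rcons h (a, t))).
  by rewrite pair_bigA; apply: eq_bigr => -[].
apply: eq_bigr => a _; rewrite !mulr_sumr; apply: eq_bigr => t _.
by rewrite prefix_prob_rcons /tprob -!mulrA.
Qed.

Lemma sum_cylinders n F (w : inf_path M) :
  \sum_(h <- histories n) F h * \1_(cylinder h) w = F (prefix_of w n).
Proof.
elim: n F => [|n IH] F.
  by rewrite /= big_seq1 indicE mem_set ?mulr1.
have pS : prefix_of w n.+1 = rcons (prefix_of w n) (w n) by rewrite /prefix_of mkseqS.
rewrite pS -(IH (fun h => F (rcons h (w n)))) /= big_allpairs_dep /=.
rewrite [LHS]big_seq [RHS]big_seq; apply: eq_bigr => h /size_histories hn.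
have cylS x : \1_(cylinder (rcons h x)) w = (w n == x)%:R * \1_(cylinder h) w :> R.
  rewrite !indicE -natrM mulnb; congr (nat_of_bool _)%:R.
  apply/idP/idP.
    rewrite inE /cylinder /= size_rcons hn pS => /eqP; rewrite eqseq_rcons => /andP[/eqP ph ->].
    exact/mem_set.
  move=> /andP[/eqP <-]; rewrite !inE /cylinder /= size_rcons hn pS => ->.
  by [].
under eq_bigr do rewrite cylS.
rewrite (bigD1 (w n))//= eqxx mul1r big1 ?addr0// => x /negbTE xn.
by rewrite eq_sym xn mul0r mulr0.
Qed.

Lemma measurable_cylinder h : measurable (cylinder h : set (path_space M)).
Proof. by apply: sub_sigma_algebra; exists h. Qed.

Let prefixE n F : (fun w : path_space M => (F (prefix_of w n))%:E) =
  (fun w => \sum_(h <- histories n) (F h * \1_(cylinder h) w)%:E)%E.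
Proof. by apply/funext => w; rewrite sumEFin sum_cylinders. Qed.

Let measurable_term F h :
  measurable_fun setT (EFin \o (fun w : path_space M => F h * \1_(cylinder h) w)).
Proof.
apply/measurable_EFinP; apply: measurable_funM; first exact: measurable_cst.
by apply: measurable_indic; exact: measurable_cylinder.
Qed.

Lemma measurable_prefix n F :
  measurable_fun setT (EFin \o (fun w : path_space M => F (prefix_of w n))).
Proof.
rewrite /comp prefixE; apply: emeasurable_sum => h; exact: measurable_term.
Qed.

Lemma integral_prefix s n F : (forall h, 0 <= F h) ->
  (\int[path_measure sch s]_w (F (prefix_of w n))%:E =
   (iter n (next sch s) F [::])%:E)%E.
Proof.
move=> F0; rewrite prefixE ge0_integral_sum//; last 2 first.
- by move=> h; exact: measurable_term.
- by move=> h w _; rewrite lee_fin mulr_ge0.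
rewrite -sum_histories -sumEFin; apply: eq_bigr => h _.
under eq_integral do rewrite EFinM.
rewrite ge0_integralZl_EFin//; last first.
  by apply/measurable_EFinP; apply: measurable_indic; exact: measurable_cylinder.
rewrite integral_indic//; last exact: measurable_cylinder.
rewrite setIT mulrC EFinM; congr (_ * _)%E; exact: path_measureE.
Qed.

End finite_horizon.

Section partial_expectation_limit.
Variables (R : realType) (M : mdp) (goal : state M).
Hypothesis goal_absorbing : absorbing goal.
Implicit Types (s t : state M) (h : seq (step M)).

Fixpoint visited s h : bool :=
  (s == goal) || (if h is (_, t) :: h' then visited t h' else false).

(** The weight is read at the first visit, so extending a sequence never changes it afterwards, even
    on sequences of the space that violate [is_path] and leave [goal] again. *)
Fixpoint hit_weight s (w : int) h : R :=
  if s == goal then w%:~R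
  else if h is (a, t) :: h' then hit_weight t (w + wgt s a) h' else 0.

Lemma hit_weight_cat s w h h' :
  visited s h -> hit_weight s w (h ++ h') = hit_weight s w h.
Proof.
elim: h s w => [|[a t] h IH] s w /=.
  by rewrite orbF => sg; case: h' => [|[a t] h'] /=; rewrite sg.
by case: eqP => //= _; exact: IH.
Qed.

Lemma hit_weight_unvisited s w h : ~~ visited s h -> hit_weight s w h = 0.
Proof.
elim: h s w => [|[a t] h IH] s w /=; first by rewrite orbF => /negbTE->.
by case: eqP => //= _; exact: IH.
Qed.

Lemma visitedP s h : visited s h ->
  exists2 i, (i <= size h)%N & last_state s (take i h) == goal.
Proof.
elim: h s => [|[a t] h IH] s /=; first by rewrite orbF => sg; exists 0%N.
case/orP => [sg|/IH[i ih tg]]; first by exists 0%N.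
by exists i.+1.
Qed.

Lemma hit_weight_first s w h : last_state s h == goal ->
  (forall i, (i < size h)%N -> last_state s (take i h) != goal) ->
  visited s h /\ hit_weight s w h = (w + path_wgt s h)%:~R.
Proof.
elim: h s w => [|[a t] h IH] s w /= hg ng.
  by rewrite (_ : s == goal)//= addr0.
have := ng 0%N isT; rewrite /last_state /= => sg; rewrite (negbTE sg)/= addrA.
by apply: IH => // i ih; exact: (ng i.+1).
Qed.

Lemma hit_weight_path s w h : is_path s h ->
  hit_weight s w h =
  if last_state s h == goal then (w + path_wgt s h)%:~R else 0.
Proof.
elim: h s w => [|[a t] h IH] s w; first by rewrite /= addr0.
move=> hp; have [sg|sg] := eqVneq s goal.
  subst s; have [-> ->] := path_from_goal R goal_absorbing hp.
  by rewrite /= !eqxx addr0.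
by rewrite /= (negbTE sg); case/andP: hp => _ /IH->; rewrite addrA.
Qed.

Lemma hit_weight_prefix s (w : inf_path M) : exists m, forall n,
  hit_weight s 0 (prefix_of w n) =
  if (m <= n)%N then weight_to_goal R goal s w else 0.
Proof.
have tk i n : (i <= n)%N -> take i (prefix_of w n) = prefix_of w i.
  by move=> ni; rewrite /prefix_of /mkseq -map_take take_iota (minn_idPl ni).
rewrite /weight_to_goal; case: pselect => [e|ne]; last first.
  (* Without a visit both sides are 0 throughout, so any [m] would do. *)
  exists 0%N => n /=; rewrite hit_weight_unvisited//; apply/negP => /visitedP[i].
  by rewrite size_mkseq => /tk-> hi; apply: ne; exists i.
case: ex_minnP => m hm mmin; exists m => n; case: leqP => [mn|nm].
  have [|vm hwm] := @hit_weight_first s 0 (prefix_of w m) hm.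
    move=> i; rewrite size_mkseq => im; rewrite tk ?(ltnW im)//.
    by apply/negP => /mmin; rewrite leqNgt im.
  by rewrite -(cat_take_drop m (prefix_of w n)) tk// hit_weight_cat// hwm add0r.
rewrite hit_weight_unvisited//; apply/negP => /visitedP[i].
rewrite size_mkseq => /[dup] ni /tk-> /mmin mi.
by have := leq_trans mi ni; rewrite leqNgt nm.
Qed.

(** Monotone convergence along prefixes; [c = 1] yields the gains and [c = -1] the losses. *)
Lemma integral_side (sch : scheduler R M) s (c : int) g :
  (forall t w, g t w = if t == goal then Num.max (c%:~R * w%:~R) 0 else 0 :> R) ->
  (\int[path_measure sch s]_w (Num.max (c%:~R * weight_to_goal R goal s w) 0)%:E =
   limn (fun n => (expect sch s 0 n g)%:E))%E.
Proof.
move=> gE; pose F h := Num.max (c%:~R * hit_weight s 0 h) 0.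
have F0 h : 0 <= F h by rewrite /F le_max lexx orbT.
have eF n : expect sch s 0 n g = iter n (next sch s) F [::].
  have FE h : is_path s h -> F h = at_end s 0 g h.
    move=> hp; rewrite /F /at_end gE hit_weight_path//; case: ifP => // _.
    by rewrite mulr0 maxxx.
  by apply/eqP; rewrite eq_le; apply/andP; split; apply: iter_next_le => // h /FE->.
have lim w : (Num.max (c%:~R * weight_to_goal R goal s w) 0)%:E =
    limn (fun n => (F (prefix_of w n))%:E).
  apply/esym/cvg_lim; first exact: ereal_hausdorff.
  have [m mP] := hit_weight_prefix s w.
  by apply: cvg_near_cst; near=> n; rewrite /F mP ifT//; near: n; exact: nbhs_infty_ge.
under eq_integral do rewrite lim.
rewrite monotone_convergence//.
- by apply: congr_lim; apply/funext => n; rewrite integral_prefix// eF.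
- by move=> n; exact: measurable_prefix.
- by move=> n w _; rewrite lee_fin.
move=> w _ i j ij; rewrite lee_fin /F.
have [m mP] := hit_weight_prefix s w; rewrite !mP.
have [mi|_] := leqP m i; first by rewrite (leq_trans mi ij).
by rewrite mulr0 maxxx le_max lexx orbT.
Unshelve. all: by end_near. Qed.

Lemma PE_limits (sch : scheduler R M) s : PE goal sch s =
  (limn (fun n => (expect sch s 0 n (gain R goal))%:E) -
   limn (fun n => (expect sch s 0 n (loss R goal))%:E))%E.
Proof.
rewrite /PE unlock integralE; congr (_ - _)%E.
  rewrite -(@integral_side sch s 1); last by move=> t w; rewrite mul1r.
  by apply: eq_integral => w _; rewrite funeposE mul1r EFin_max.
rewrite -(@integral_side sch s (-1)); last by move=> t w; rewrite mulN1r.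
by apply: eq_integral => w _; rewrite funenegE mulN1r EFin_max EFinN.
Qed.

Lemma cvg_expect (sch : scheduler R M) s g : (forall t w, 0 <= g t w) ->
  {homo (fun n => expect sch s 0 n g) : m n / (m <= n)%N >-> m <= n} ->
  [/\ cvgn (fun n => (expect sch s 0 n g)%:E),
      (0 <= limn (fun n => (expect sch s 0 n g)%:E))%E &
      forall n, ((expect sch s 0 n g)%:E <= limn (fun n => (expect sch s 0 n g)%:E))%E].
Proof.
move=> g0 nd; have nd' : nondecreasing_seq (fun n => (expect sch s 0 n g)%:E).
  by move=> m n mn; rewrite lee_fin nd.
have cv := ereal_nondecreasing_is_cvgn nd'; split => //.
  by apply: lime_ge => //; near=> n; rewrite lee_fin expect_ge0.
by move=> n; apply: lime_ge => //; near=> m; apply: nd'; near: m; exact: nbhs_infty_ge.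
Unshelve. all: by end_near. Qed.

Lemma achievable_PE s v : achievable goal s 0 v -> (v%:E <= PE_sup R goal s)%E.
Proof.
move=> [sch [N [C [lossC vN]]]].
have [_ _ /(_ N) leG] := cvg_expect (gain_ge0 R goal) (expect_gain_nd goal_absorbing sch s 0).
have [cvL _ _] := cvg_expect (loss_ge0 R goal) (expect_loss_nd goal_absorbing sch s 0).
apply: (@le_trans _ _ (PE goal sch s)); last first.
  by apply: ereal_sup_ubound; exists sch.
apply: (@le_trans _ _ ((expect sch s 0 N (gain R goal))%:E - C%:E)%E).
  by rewrite -EFinB lee_fin.
rewrite PE_limits; apply: leeB => //.
by apply: lime_le => //; near=> n; rewrite lee_fin.
Unshelve. all: by end_near. Qed.

End partial_expectation_limit.

(** * Attainment of the supremum *)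

Theorem theorem15 (R : realType) (M : mdp) (goal : state M)
    (all_reachable : forall s : state M, reachable (init M) s)
    (goal_absorbing : absorbing goal)
    (collapsed : fail_collapsed goal)
    (finite_sup : PE_sup R goal (init M) \is a fin_num) :
  exists sch : scheduler R M,
    [/\ weight_based sch, deterministic sch
      & PE_sup R goal (init M) = PE goal sch (init M)].
Proof.
have bounded s : ~~ unbounded R goal s.
  apply/negP => us; move: finite_sup.
  case E: (PE_sup R goal (init M)) => [r| |]// _.
  have := achievable_PE goal_absorbing (unbounded_infinite goal_absorbing
    collapsed us (all_reachable s) (r + 1)).
  by rewrite E lee_fin gerDl ler10.
have [pi [epi [[c gain_c] opt]]] :=
  optimal_policy goal_absorbing collapsed bounded (init M).
set sch := stationary R epi in gain_c opt.
exists sch; split.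
- exact: stationary_weight_based.
- exact: stationary_deterministic.
apply/eqP; rewrite eq_le; apply/andP; split; last first.
  by apply: ereal_sup_ubound; exists sch.
apply: ub_ereal_sup => _ [sig _ <-]; rewrite !PE_limits//.
have nd (sg : scheduler R M) := expect_gain_nd goal_absorbing sg (init M) 0.
have nl (sg : scheduler R M) := expect_loss_nd goal_absorbing sg (init M) 0.
have [_ l0 leL] := cvg_expect (loss_ge0 R goal) (nl sig).
have [cvG g0 leG] := cvg_expect (gain_ge0 R goal) (nd sig).
have [cvL l0' leL'] := cvg_expect (loss_ge0 R goal) (nl sch).
rewrite [limn (fun n => (expect sch _ _ _ (gain R goal))%:E)]
  (_ : _ = (limn (fun n => expect sch (init M) 0 n (gain R goal)))%:E); last first.
  apply: EFin_lim; apply: nondecreasing_is_cvgn; first exact: nd.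
  by exists c => _ [n _ <-]; exact: gain_c.
set F := limn (fun n => expect sch _ _ _ _) in opt *.
(* An infinite expected loss makes the value of [sig] equal to [-oo], even against an infinite
   gain. *)
move: l0 leL; case: (limn _) => [C| |]// C0 leL; last by rewrite addeNy leNye.
have main N' N : expect sig (init M) 0 N (gain R goal) <=
    F - expect sch (init M) 0 N' (loss R goal) + C.
  by rewrite -lerBlDr; apply: opt => n; rewrite -lee_fin.
move: cvG g0 leG; set P := limn _ => cvG P0 leG.
(* Letting [N] grow first shows that the gain [P] of [sig] is finite; letting [N'] grow then bounds
   the total loss [L] of [sch]. *)
have leP N' : (P <= (F - expect sch (init M) 0 N' (loss R goal) + C)%:E)%E.
  by apply: lime_le => //; near=> n; rewrite lee_fin.
move: P0 leP; case: P {cvG leG} => [p| |] // p0 leP; last first.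
  by have := leP 0%N; rewrite leye_eq.
move: cvL l0' leL'; set L := limn _ => cvL L0 leL'.
have : (L <= (F + C - p)%:E)%E.
  apply: lime_le => //; near=> n; rewrite lee_fin.
  by have := leP n; rewrite lee_fin; lra.
move: L0; case: L {cvL leL'} => [l| |] // _.
by rewrite -!EFinB !lee_fin; lra.
Unshelve. all: by end_near. Qed.
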